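(* Let $H$ be a cocommutative weak Hopf algebra in $\mathsf{C}$, let $(B,\varphi_B)$ be a left weak $H$-module algebra and let $\sigma\in Reg_{\varphi_B}(H^{\otimes 2},B)$ satisfy the twisted condition. Then the pre-obstruction $\omega_\sigma$ of $\sigma$ is a 3-cocycle, i.e. $$\partial_{3,0}(\omega_\sigma)\ast\partial_{3,2}(\omega_\sigma)\ast\partial_{3,4}(\omega_\sigma)=\partial_{3,1}(\omega_\sigma)\ast\partial_{3,3}(\omega_\sigma).$$
   Context: Category. $\mathsf{C}$ is a strict symmetric monoidal category with tensor product $\otimes$, unit object $K$ and symmetry $c$, in which every idempotent splits. For an object $M$ and a morphism $f$, $M\otimes f$ and $f\otimes M$ mean $id_M\otimes f$ and $f\otimes id_M$. Algebras $(A,\eta_A,\mu_A)$ are unital and associative, coalgebras $(D,\varepsilon_D,\delta_D)$ counital and coassociative; $\delta_{D\otimes E}=(D\otimes c_{D,E}\otimes E)\circ(\delta_D\otimes\delta_E)$. $D$ is cocommutative if $c_{D,D}\circ\delta_D=\delta_D$. For $f,g:D\to A$ the convolution is $f\ast g=\mu_A\circ(f\otimes g)\circ\delta_D$. Weak Hopf algebra. An object $H$ with algebra structure $(\eta_H,\mu_H)$ and coalgebra structure $(\varepsilon_H,\delta_H)$ such that: (a1) $\delta_H\circ\mu_H=(\mu_H\otimes\mu_H)\circ\delta_{H\otimes H}$; (a2) $\varepsilon_H\circ\mu_H\circ(\mu_H\otimes H)=((\varepsilon_H\circ\mu_H)\otimes(\varepsilon_H\circ\mu_H))\circ(H\otimes\delta_H\otimes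 H)=((\varepsilon_H\circ\mu_H)\otimes(\varepsilon_H\circ\mu_H))\circ(H\otimes(c_{H,H}\circ\delta_H)\otimes H)$; (a3) $(\delta_H\otimes H)\circ\delta_H\circ\eta_H=(H\otimes\mu_H\otimes H)\circ((\delta_H\circ\eta_H)\otimes(\delta_H\circ\eta_H))=(H\otimes(\mu_H\circ c_{H,H})\otimes H)\circ((\delta_H\circ\eta_H)\otimes(\delta_H\circ\eta_H))$; and there is an antipode $\lambda_H:H\to H$ with (a4) $id_H\ast\lambda_H=\Pi_H^L:=((\varepsilon_H\circ\mu_H)\otimes H)\circ(H\otimes c_{H,H})\circ((\delta_H\circ\eta_H)\otimes H)$, (a5) $\lambda_H\ast id_H=\Pi_H^R:=(H\otimes(\varepsilon_H\circ\mu_H))\circ(c_{H,H}\otimes H)\circ(H\otimes(\delta_H\circ\eta_H))$, (a6) $\lambda_H\ast id_H\ast\lambda_H=\lambda_H$. Actions. For an algebra $B$, $(B,\varphi_B)$ with $\varphi_B:H\otimes B\to B$ is a left weak $H$-module algebra if (b1) $\varphi_B\circ(H\otimes\mu_B)=\mu_B\circ(\varphi_B\otimes\varphi_B)\circ(H\otimes c_{H,B}\otimes B)\circ(\delta_H\otimes B\otimes B)$, (b2) $\varphi_B\circ(\eta_H\otimes B)=id_B$ and (b3) $u_1^{\varphi_B}\circ\mu_H=\varphi_B\circ(H\otimes u_1^{\varphi_B})$, where $u_1^{\varphi_B}=\varphi_B\circ(H\otimes\eta_B)$. For $n\ge 2$, $u_n^{\varphi_B}=u_1^{\varphi_B}\circ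 m_H^{\otimes n}$, where $m_H^{\otimes n}:H^{\otimes n}\to H$ is the iterated product. Regular morphisms. $Reg_{\varphi_B}(H^{\otimes n},B)$ is the group (under $\ast$, with unit $u_n^{\varphi_B}$) of morphisms $\sigma:H^{\otimes n}\to B$ for which there is $\sigma^{-1}:H^{\otimes n}\to B$ with $\sigma\ast\sigma^{-1}=\sigma^{-1}\ast\sigma=u_n^{\varphi_B}$, $\sigma\ast\sigma^{-1}\ast\sigma=\sigma$, $\sigma^{-1}\ast\sigma\ast\sigma^{-1}=\sigma^{-1}$. Twisted condition on $\sigma:H\otimes H\to B$. With $P_{\varphi_B}=(\varphi_B\otimes H)\circ(H\otimes c_{H,B})\circ(\delta_H\otimes B)$ and $F_\sigma=(\sigma\otimes\mu_H)\circ\delta_{H\otimes H}$: $\mu_B\circ(B\otimes\sigma)\circ(P_{\varphi_B}\otimes H)\circ(H\otimes P_{\varphi_B})=\mu_B\circ(B\otimes\varphi_B)\circ(F_\sigma\otimes B)$. Coface operators. For $k\ge1$, $\partial_{k,i}:Reg_{\varphi_B}(H^{\otimes k},B)\to Reg_{\varphi_B}(H^{\otimes(k+1)},B)$: $\partial_{k,0}(\sigma)=\varphi_B\circ(H\otimes\sigma)$; $\partial_{k,i}(\sigma)=\sigma\circ(H^{\otimes(i-1)}\otimes\mu_H\otimes H^{\otimes(k-i)})$ for $1\le i\le k$; $\partial_{k,k+1}(\sigma)=\sigma\circ(H^{\otimes(k-1)}\otimes(\mu_H\circ(H\otimes\Pi_H^L)))$. Pre-obstruction. For $\sigma\in Reg_{\varphi_B}(H^{\otimes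 2},B)$, $\omega_\sigma=\partial_{2,0}(\sigma)\ast\partial_{2,2}(\sigma)\ast\partial_{2,1}(\sigma)^{-1}\ast\partial_{2,3}(\sigma)^{-1}\in Reg_{\varphi_B}(H^{\otimes3},B)$. *)

(* Defs.v *)
From mathcomp Require Import all_boot.
From Stdlib Require Import ClassicalEpsilon.

Set Implicit Arguments.
Unset Strict Implicit.
Unset Printing Implicit Defensive.

Declare Scope ob_scope.
Declare Scope mor_scope.
Delimit Scope ob_scope with ob.
Delimit Scope mor_scope with mor.

Record category := Category {
  Ob : Type;
  Hom : Ob -> Ob -> Type;
  idm : forall A, Hom A A;
  comp : forall A B C, Hom B C -> Hom A B -> Hom A C;
  comp_idl : forall A B (f : Hom A B), comp (idm B) f = f;
  comp_idr : forall A B (f : Hom A B), comp f (idm A) = f;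
  compA : forall A B C D (h : Hom C D) (g : Hom B C) (f : Hom A B),
    comp h (comp g f) = comp (comp h g) f }.

Arguments Hom {c} A%_ob B%_ob.
Arguments idm {c} A%_ob.
Arguments comp {c A B C} g%_mor f%_mor : rename.
Bind Scope ob_scope with Ob.
Bind Scope mor_scope with Hom.

(* Strictness identifies objects such as (A ⊗ B) ⊗ C and A ⊗ (B ⊗ C), but only
   propositionally, so the two sides of an equation between morphisms may live
   in different (provably equal) types.  [f ≡ g] is equality of morphisms of
   the category: equal source, equal target, and equal as morphisms. *)
Inductive mor_eq (C : category) (A B : Ob C) (f : Hom A B) :
    forall A' B' : Ob C, Hom A' B' -> Prop :=
  mor_eq_refl : mor_eq f f.

Notation "f ≡ g" := (mor_eq f%mor g%mor) (at level 70, no associativity).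

Record strict_monoidal := StrictMonoidal {
  sm_cat :> category;
  tens : Ob sm_cat -> Ob sm_cat -> Ob sm_cat;
  tunit : Ob sm_cat;
  tensm : forall A B A' B' : Ob sm_cat,
    Hom A B -> Hom A' B' -> Hom (tens A A') (tens B B');
  tensm_id : forall A B : Ob sm_cat,
    tensm (idm A) (idm B) = idm (tens A B);
  tensm_comp : forall (A B C A' B' C' : Ob sm_cat)
      (g : Hom B C) (f : Hom A B) (g' : Hom B' C') (f' : Hom A' B'),
    tensm (comp g f) (comp g' f') = comp (tensm g g') (tensm f f');
  tensA : forall A B C, tens A (tens B C) = tens (tens A B) C;
  tens1o : forall A, tens tunit A = A;
  tenso1 : forall A, tens A tunit = A;
  tensmA : forall (A A' B B' C C' : Ob sm_cat)
      (f : Hom A A') (g : Hom B B') (h : Hom C C'),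
    tensm f (tensm g h) ≡ tensm (tensm f g) h;
  tensm1o : forall (A B : Ob sm_cat) (f : Hom A B), tensm (idm tunit) f ≡ f;
  tensmo1 : forall (A B : Ob sm_cat) (f : Hom A B), tensm f (idm tunit) ≡ f }.

Arguments tens {s} A%_ob B%_ob : rename.
Arguments tunit {s}.
Arguments tensm {s A B A' B'} f%_mor g%_mor : rename.
Notation "A ⊗ B" := (tens A B) (at level 38, left associativity) : ob_scope.
Notation "f ⊗ g" := (tensm f g) (at level 38, left associativity) : mor_scope.

(* The n-th tensor power, with tpow A 1 = A and tpow A 2 = A ⊗ A by
   conversion. *)
Fixpoint tpow (C : strict_monoidal) (A : Ob C) (n : nat) : Ob C :=
  match n with
  | 0 => tunit
  | 1 => A
  | n'.+1 => (A ⊗ tpow A n')%ob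
  end.

(* Equality of objects, solved automatically when it follows from strictness. *)
Class ob_eq (C : category) (A B : Ob C) : Prop := ob_eqP : A = B.
Ltac strict_ob :=
  rewrite /ob_eq; cbn [tpow]; rewrite ?tensA ?tens1o ?tenso1; reflexivity.
#[global] Hint Extern 0 (ob_eq _ _) => (exact: erefl) : typeclass_instances.
#[global] Hint Extern 1 (ob_eq _ _) => strict_ob : typeclass_instances.

Definition recast (C : category) (A B A' B' : Ob C) (f : Hom A B)
    {eA : ob_eq A A'} {eB : ob_eq B B'} : Hom A' B' :=
  match eA in _ = X, eB in _ = Y return Hom X Y with
  | erefl, erefl => f
  end.
Arguments recast {C A B A' B'} f%_mor {eA eB}.

Definition scomp (C : category) (A B B' D : Ob C) (g : Hom B' D) (f : Hom A B)
    {e : ob_eq B B'} : Hom A D :=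
  comp g (recast (eA := erefl) (eB := e) f).
Arguments scomp {C A B B' D} g%_mor f%_mor {e}.
Notation "g ∘ f" := (scomp g f) (at level 40, left associativity) : mor_scope.

Record strict_symmetric_monoidal := StrictSymmetricMonoidal {
  ssm_sm :> strict_monoidal;
  sym : forall A B : Ob ssm_sm, Hom (A ⊗ B) (B ⊗ A);
  sym_nat : forall (A A' B B' : Ob ssm_sm) (f : Hom A A') (g : Hom B B'),
    (sym A' B' ∘ (f ⊗ g))%mor = ((g ⊗ f) ∘ sym A B)%mor;
  symK : forall A B : Ob ssm_sm, (sym B A ∘ sym A B)%mor = idm (A ⊗ B);
  sym_hex : forall A B D : Ob ssm_sm,
    sym A (B ⊗ D) ≡ (idm B ⊗ sym A D) ∘ (sym A B ⊗ idm D) }.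

Arguments sym {s} A%_ob B%_ob : rename.

Definition idempotents_split (C : category) : Prop :=
  forall (A : Ob C) (e : Hom A A), (e ∘ e)%mor = e ->
  exists (B : Ob C) (p : Hom A B) (i : Hom B A),
    (i ∘ p)%mor = e /\ (p ∘ i)%mor = idm B.

Local Open Scope mor_scope.

Section Structures.

Context {C : strict_symmetric_monoidal}.

Record is_algebra (A : Ob C) (eta : Hom tunit A) (mu : Hom (A ⊗ A) A) : Prop :=
  IsAlgebra {
    alg_unitl : mu ∘ (eta ⊗ idm A) ≡ idm A;
    alg_unitr : mu ∘ (idm A ⊗ eta) ≡ idm A;
    alg_assoc : mu ∘ (mu ⊗ idm A) ≡ mu ∘ (idm A ⊗ mu) }.

Record is_coalgebra (D : Ob C) (eps : Hom D tunit) (delta : Hom D (D ⊗ D)) :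
    Prop := IsCoalgebra {
  coalg_counitl : (eps ⊗ idm D) ∘ delta ≡ idm D;
  coalg_counitr : (idm D ⊗ eps) ∘ delta ≡ idm D;
  coalg_coassoc : (delta ⊗ idm D) ∘ delta ≡ (idm D ⊗ delta) ∘ delta }.

Record algebra := Algebra {
  alg_ob :> Ob C;
  alg_eta : Hom tunit alg_ob;
  alg_mu : Hom (alg_ob ⊗ alg_ob) alg_ob;
  alg_ax : is_algebra alg_eta alg_mu }.

Definition tens_delta (D E : Ob C) (dD : Hom D (D ⊗ D)) (dE : Hom E (E ⊗ E)) :
    Hom (D ⊗ E) ((D ⊗ E) ⊗ (D ⊗ E)) :=
  recast ((idm D ⊗ sym D E ⊗ idm E) ∘ (dD ⊗ dE)).

Definition conv (D A : Ob C) (delta : Hom D (D ⊗ D)) (mu : Hom (A ⊗ A) A)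
    (f g : Hom D A) : Hom D A :=
  mu ∘ (f ⊗ g) ∘ delta.

Section WeakHopf.

Variables (H : Ob C) (eta : Hom tunit H) (mu : Hom (H ⊗ H) H).
Variables (eps : Hom H tunit) (delta : Hom H (H ⊗ H)).

Definition PiL_of : Hom H H :=
  recast (((eps ∘ mu) ⊗ idm H) ∘ (idm H ⊗ sym H H) ∘ ((delta ∘ eta) ⊗ idm H)).

Definition PiR_of : Hom H H :=
  recast ((idm H ⊗ (eps ∘ mu)) ∘ (sym H H ⊗ idm H) ∘ (idm H ⊗ (delta ∘ eta))).

Record is_weak_hopf (lambda : Hom H H) : Prop := IsWeakHopf {
  wh_alg : is_algebra eta mu;
  wh_coalg : is_coalgebra eps delta;
  wh_a1 : delta ∘ mu = (mu ⊗ mu) ∘ tens_delta delta delta;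
  wh_a2l : eps ∘ mu ∘ (mu ⊗ idm H)
    ≡ ((eps ∘ mu) ⊗ (eps ∘ mu)) ∘ (idm H ⊗ delta ⊗ idm H);
  wh_a2r : eps ∘ mu ∘ (mu ⊗ idm H)
    ≡ ((eps ∘ mu) ⊗ (eps ∘ mu)) ∘ (idm H ⊗ (sym H H ∘ delta) ⊗ idm H);
  wh_a3l : (delta ⊗ idm H) ∘ delta ∘ eta
    ≡ (idm H ⊗ mu ⊗ idm H) ∘ ((delta ∘ eta) ⊗ (delta ∘ eta));
  wh_a3r : (delta ⊗ idm H) ∘ delta ∘ eta
    ≡ (idm H ⊗ (mu ∘ sym H H) ⊗ idm H) ∘ ((delta ∘ eta) ⊗ (delta ∘ eta));
  wh_a4 : conv delta mu (idm H) lambda = PiL_of;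
  wh_a5 : conv delta mu lambda (idm H) = PiR_of;
  wh_a6 : conv delta mu (conv delta mu lambda (idm H)) lambda = lambda }.

End WeakHopf.

Record weak_hopf := WeakHopf {
  wh_ob :> Ob C;
  wh_eta : Hom tunit wh_ob;
  wh_mu : Hom (wh_ob ⊗ wh_ob) wh_ob;
  wh_eps : Hom wh_ob tunit;
  wh_delta : Hom wh_ob (wh_ob ⊗ wh_ob);
  wh_lambda : Hom wh_ob wh_ob;
  wh_ax : is_weak_hopf wh_eta wh_mu wh_eps wh_delta wh_lambda }.

Definition cocommutative (H : weak_hopf) : Prop :=
  sym H H ∘ wh_delta H = wh_delta H.

Definition PiL (H : weak_hopf) : Hom H H :=
  PiL_of (wh_eta H) (wh_mu H) (wh_eps H) (wh_delta H).

Fixpoint tpow_mu (H : weak_hopf) (n : nat) : Hom (tpow H n) H :=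
  match n return Hom (tpow H n) H with
  | 0 => wh_eta H
  | n'.+1 =>
    match n' return Hom (tpow H n') H -> Hom (tpow H n'.+1) H with
    | 0 => fun _ => idm H
    | _.+1 => fun m => wh_mu H ∘ (idm H ⊗ m)
    end (tpow_mu H n')
  end.

Fixpoint tpow_delta (H : weak_hopf) (n : nat) :
    Hom (tpow H n) (tpow H n ⊗ tpow H n) :=
  match n return Hom (tpow H n) (tpow H n ⊗ tpow H n) with
  | 0 => recast (idm tunit)
  | n'.+1 =>
    match n' return Hom (tpow H n') (tpow H n' ⊗ tpow H n') ->
                    Hom (tpow H n'.+1) (tpow H n'.+1 ⊗ tpow H n'.+1) with
    | 0 => fun _ => wh_delta H
    | _.+1 => fun d => tens_delta (wh_delta H) d
    end (tpow_delta H n')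
  end.

Definition u1 (H : weak_hopf) (B : algebra) (phi : Hom (H ⊗ B) B) : Hom H B :=
  recast (phi ∘ (idm H ⊗ alg_eta B)).

Record is_weak_module_algebra (H : weak_hopf) (B : algebra)
    (phi : Hom (H ⊗ B) B) : Prop := IsWeakModuleAlgebra {
  wma_b1 : phi ∘ (idm H ⊗ alg_mu B)
    ≡ alg_mu B ∘ (phi ⊗ phi) ∘ (idm H ⊗ sym H B ⊗ idm B)
      ∘ (wh_delta H ⊗ idm B ⊗ idm B);
  wma_b2 : phi ∘ (wh_eta H ⊗ idm B) ≡ idm B;
  wma_b3 : u1 phi ∘ wh_mu H = phi ∘ (idm H ⊗ u1 phi) }.

Lemma tpowS (A : Ob C) n : tpow A n.+1 = (A ⊗ tpow A n)%ob.
Proof. by case: n => [|n] //=; rewrite tenso1. Qed.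

Lemma tpowD (A : Ob C) m n : tpow A (m + n) = (tpow A m ⊗ tpow A n)%ob.
Proof.
by elim: m => [|m IH]; rewrite ?tens1o // addSn !tpowS IH tensA.
Qed.

Lemma tpow_mid_dom (A : Ob C) k i : 0 < i <= k ->
  (tpow A i.-1 ⊗ (A ⊗ A) ⊗ tpow A (k - i))%ob = tpow A k.+1.
Proof.
case: i => // i lt_ik; rewrite succnK.
have -> : k.+1 = i + (k - i.+1).+2 by rewrite 2!addnS -addSn subnKC.
by rewrite tpowD !tpowS !tensA.
Qed.

Lemma tpow_mid_cod (A : Ob C) k i : 0 < i <= k ->
  (tpow A i.-1 ⊗ A ⊗ tpow A (k - i))%ob = tpow A k.
Proof.
case: i => // i lt_ik; rewrite succnK.
have -> : tpow A k = tpow A (i + (k - i.+1).+1).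
  by rewrite addnS -addSn subnKC.
by rewrite tpowD !tpowS !tensA.
Qed.

Lemma tpow_last_dom (A : Ob C) k : 0 < k ->
  (tpow A k.-1 ⊗ (A ⊗ A))%ob = tpow A k.+1.
Proof.
case: k => // k _; rewrite succnK -addn2.
exact/esym/(tpowD A k 2).
Qed.

Lemma tpow_last_cod (A : Ob C) k : 0 < k ->
  (tpow A k.-1 ⊗ A)%ob = tpow A k.
Proof. by case: k => // k _; rewrite succnK -addn1 tpowD. Qed.

Section Cochains.

Variables (H : weak_hopf) (B : algebra) (phi : Hom (H ⊗ B) B).

Definition cconv n (f g : Hom (tpow H n) B) : Hom (tpow H n) B :=
  conv (tpow_delta H n) (alg_mu B) f g.

(* For n = 1 this is u1 phi, as tpow_mu H 1 = idm H. *)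
Definition un n : Hom (tpow H n) B := u1 phi ∘ tpow_mu H n.

Definition is_reg_inverse n (s t : Hom (tpow H n) B) : Prop :=
  [/\ cconv s t = un n, cconv t s = un n,
      cconv (cconv s t) s = s & cconv (cconv t s) t = t].

Definition Reg n (s : Hom (tpow H n) B) : Prop :=
  exists t, is_reg_inverse s t.

(* The inverse in the group of regular morphisms; only meaningful when
   [Reg s] holds, in which case it is the unique t with is_reg_inverse s t. *)
Definition reg_inv n (s : Hom (tpow H n) B) : Hom (tpow H n) B :=
  epsilon (inhabits (un n)) (is_reg_inverse s).

Definition P_phi : Hom (H ⊗ B) (B ⊗ H) :=
  (phi ⊗ idm H) ∘ (idm H ⊗ sym H B) ∘ (wh_delta H ⊗ idm B).

Definition F_of (s : Hom (H ⊗ H) B) : Hom (H ⊗ H) (B ⊗ H) :=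
  (s ⊗ wh_mu H) ∘ tens_delta (wh_delta H) (wh_delta H).

Definition twisted (s : Hom (H ⊗ H) B) : Prop :=
  alg_mu B ∘ (idm B ⊗ s) ∘ (P_phi ⊗ idm H) ∘ (idm H ⊗ P_phi)
  ≡ alg_mu B ∘ (idm B ⊗ phi) ∘ (F_of s ⊗ idm B).

Definition coface_first k (s : Hom (tpow H k) B) : Hom (tpow H k.+1) B :=
  recast (eA := esym (tpowS H k)) (eB := erefl) (phi ∘ (idm H ⊗ s)).

Definition coface_mid k i (hi : 0 < i <= k) (s : Hom (tpow H k) B) :
    Hom (tpow H k.+1) B :=
  s ∘ recast (eA := tpow_mid_dom H hi) (eB := tpow_mid_cod H hi)
        (idm (tpow H i.-1) ⊗ wh_mu H ⊗ idm (tpow H (k - i))).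

Definition coface_last k (hk : 0 < k) (s : Hom (tpow H k) B) :
    Hom (tpow H k.+1) B :=
  s ∘ recast (eA := tpow_last_dom H hk) (eB := tpow_last_cod H hk)
        (idm (tpow H k.-1) ⊗ (wh_mu H ∘ (idm H ⊗ PiL H))).

(* The coface operator ∂_{k,i}, for k >= 1 and 0 <= i <= k + 1. *)
Definition coface k i (hki : (0 < k) && (i <= k.+1)) (s : Hom (tpow H k) B) :
    Hom (tpow H k.+1) B :=
  if i == 0 then coface_first s else
  (if 0 < i <= k as b return (0 < i <= k) = b -> Hom (tpow H k.+1) B
   then fun hi => coface_mid hi s
   else fun _ => coface_last (proj1 (andP hki)) s) erefl.

End Cochains.

End Structures.

Arguments algebra : clear implicits.
Arguments weak_hopf : clear implicits.

Notation "f ∗ g" := (cconv f g) (at level 42, left associativity) : mor_scope.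
(* Usable at concrete k and i, where the bound on k and i is computed. *)
Notation "'∂_(' k , i ) phi" := (@coface _ _ _ phi k i isT)
  (at level 10, phi at level 9, format "'∂_(' k ,  i )  phi") : mor_scope.

Section Obstruction.

Context {C : strict_symmetric_monoidal}.
Variables (H : weak_hopf C) (B : algebra C) (phi : Hom (H ⊗ B) B).

Definition pre_obstruction (s : Hom (tpow H 2) B) : Hom (tpow H 3) B :=
  (∂_(2, 0) phi) s ∗ (∂_(2, 2) phi) s
  ∗ reg_inv phi ((∂_(2, 1) phi) s) ∗ reg_inv phi ((∂_(2, 3) phi) s).

Definition is_3cocycle (w : Hom (tpow H 3) B) : Prop :=
  Reg phi w /\
  (∂_(3, 0) phi) w ∗ (∂_(3, 2) phi) w ∗ (∂_(3, 4) phi) w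
  = (∂_(3, 1) phi) w ∗ (∂_(3, 3) phi) w.

End Obstruction.

(* Main.v *)
From mathcomp Require Import all_boot.
From Stdlib Require Import ClassicalEpsilon Eqdep.
Require Import Defs.

Set Implicit Arguments.
Unset Strict Implicit.
Unset Printing Implicit Defensive.

(** Why the pre-obstruction is a cocycle.

    Suppose first that morphisms can be evaluated on elements.  Write [x ▷ f]
    for the action, [⋆] for the product of [B] and [∙] for that of [H].  By its
    definition, [omega] compares the two ways of bracketing a triple product:
      [x ▷ sigma(y, z) ⋆ sigma(x, y ∙ z)
         = omega(x, y, z) ⋆ sigma(x, y) ⋆ sigma(x ∙ y, z)].
    Applying this relation to the product
      [x ▷ y ▷ sigma(z, w) ⋆ x ▷ sigma(y, z ∙ w) ⋆ sigma(x, y ∙ z ∙ w)]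
    from the left and from the right gives the two sides of the cocycle
    equation, each multiplied by the same invertible factor
    [sigma(x, y) ⋆ sigma(x ∙ y, z) ⋆ sigma(x ∙ y ∙ z, w)]; this is
    [omega_cocycle].  The values of [omega] have to be moved past other factors
    on the way, so they must be central ([omega_central]).  Here the twisted
    condition enters: both sides of the relation above intertwine the operators
    [x ▷ y ▷ z ▷ _] and [(x ∙ y ∙ z) ▷ _], so their quotient [omega(x, y, z)]
    commutes with every [x ▷ y ▷ z ▷ f].  These values are all of [B] up to a
    central idempotent ([act_surj]): the operator [x ▷ _] is inverted, up to
    the idempotent [x ▷ 1], by acting with the antipode of [x] and conjugating
    by a value of [sigma].

    Elements are supplied by cocommutativity.  For a cocommutative coalgebra
    [E], a point of [H] over [E] is a morphism from [E] to [H] that respects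
    comultiplications; it need not respect counits, as the product of a weak
    Hopf algebra does not.  Points are closed under products, under the target
    map and under the antipode, and morphisms from [E] to [B] form a monoid
    under convolution on which points act.  A cochain is determined by its
    value at the projections of a tensor power of [H], which are points, so all
    the equations between cochains become equations between values at points.

    The weak axioms only enter through a few equations between string diagrams.
    The main one is [target_delta], which reads in Sweedler notation
    Pi(h_1) ⊗ h_2 = 1_1 ⊗ 1_2 h.  It implies that [x ▷ 1] is a central
    idempotent through which the target of [x] acts ([act_tgt],
    [act1_central]), that the target map is comultiplicative
    ([delta_target]), and that the last coface operator only multiplies a
    cochain by such an idempotent ([ev2_tgt]).  The antipode is comultiplicative
    by uniqueness of inverses in a convolution algebra ([comult_antipode]). *)

(** * Morphisms without types *)
Section Arrows.

Context {C : category}.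

Record arrow := Arrow { adom : Ob C; acod : Ob C; amor : Hom adom acod }.

(** In a strict monoidal category the two bracketings of a triple tensor product
    of morphisms have types that are only provably equal.  Forgetting the types
    turns associativity and unitality of the tensor product into plain
    equations, at the price of a partial composition; [None] stands for an
    ill-typed composite, and makes associativity of composition
    unconditional. *)
Definition arr := option arrow.

Definition pk (A B : Ob C) (f : Hom A B) : arr := Some (Arrow f).

Definition acomp (G F : arr) : arr :=
  match G, F with
  | Some g, Some f =>
    match excluded_middle_informative (acod f = adom g) with
    | left e => pk (scomp (amor g) (amor f) (e := e))
    | right _ => None
    end
  | _, _ => None
  end.

Definition aid (A : Ob C) : arr := pk (idm A).

(** The typing information that the interchange and unit laws still need; as a
    class, it is recovered from the shape of the expression at each rewrite. *)
Class typed (F : arr) (A B : Ob C) : Prop := typedP : exists f : Hom A B, F = pk f.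

Lemma mor_eqP (A B A' B' : Ob C) (f : Hom A B) (f' : Hom A' B') :
  f ≡ f' <-> pk f = pk f'.
Proof.
split=> [[]//|e].
suff amor_eq (p q : arrow) : Some p = Some q -> amor p ≡ amor q by exact: amor_eq e.
by case=> ->.
Qed.

(** Injectivity uses uniqueness of identity proofs on objects. *)
Lemma pk_inj (A B : Ob C) : injective (@pk A B).
Proof.
move=> f g [e]; have e2 := inj_pairT2 _ _ _ _ _ e.
exact: (inj_pairT2 _ _ _ _ _ e2).
Qed.

Lemma pk_scomp (A B B' D : Ob C) (g : Hom B' D) (f : Hom A B) (e : ob_eq B B') :
  pk (scomp g f (e := e)) = acomp (pk g) (pk f).
Proof.
rewrite /acomp /=; case: excluded_middle_informative => [e'|/(_ e)//].
by rewrite (UIP _ _ _ e' e).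
Qed.

Lemma pk_comp (A B D : Ob C) (g : Hom B D) (f : Hom A B) :
  pk (comp g f) = acomp (pk g) (pk f).
Proof. exact: (pk_scomp g f (erefl : ob_eq B B)). Qed.

Lemma pk_recast (A B A' B' : Ob C) (f : Hom A B) (eA : ob_eq A A')
  (eB : ob_eq B B') : pk (recast f (eA := eA) (eB := eB)) = pk f.
Proof. by destruct eA, eB. Qed.

Lemma acompA F G K : acomp K (acomp G F) = acomp (acomp K G) F.
Proof.
have acompN X : acomp X None = None :> arr by case: X.
case: F => [[A B f]|]; last by rewrite !acompN.
case: G => [[B' D g]|]; last by case: K.
case: K => [[D' X k]|] //.
case: (excluded_middle_informative (B = B')) => [e|ne]; last first.
  have H0 Y' (h : Hom B' Y') : acomp (Some (Arrow h)) (Some (Arrow f)) = None :> arr.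
    by rewrite /acomp /=; case: excluded_middle_informative.
  rewrite (H0 D g) /=; case: excluded_middle_informative => //= e'.
  by case: excluded_middle_informative.
case: (excluded_middle_informative (D = D')) => [e'|ne']; last first.
  rewrite /acomp /=; case: excluded_middle_informative => // e1 /=.
  by do 2 case: excluded_middle_informative => //=.
destruct e, e'.
change (acomp (pk k) (acomp (pk g) (pk f)) = acomp (acomp (pk k) (pk g)) (pk f)).
by rewrite -!pk_comp compA.
Qed.

#[global] Instance typed_pk (A B : Ob C) (f : Hom A B) : typed (pk f) A B.
Proof. by exists f. Qed.

#[global] Instance typed_id (A : Ob C) : typed (aid A) A A.
Proof. by exists (idm A). Qed.

#[global] Instance typed_comp G F (A B B' D : Ob C) (tF : typed F A B)
  (tG : typed G B' D) (e : ob_eq B B') : typed (acomp G F) A D.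
Proof.
case: tF tG => [f ->] [g ->].
by exists (scomp g f (e := e)); rewrite pk_scomp.
Qed.

Lemma typed_cast F (A B A' B' : Ob C) (tF : typed F A B) (eA : ob_eq A A')
  (eB : ob_eq B B') : typed F A' B'.
Proof. by destruct eA, eB. Qed.

Lemma aidl F (A B B' : Ob C) (tF : typed F A B) (e : ob_eq B B') :
  acomp (aid B') F = F.
Proof.
by case: tF => f ->; destruct e; rewrite -pk_comp comp_idl.
Qed.

Lemma aidr F (A A' B : Ob C) (tF : typed F A B) (e : ob_eq A A') :
  acomp F (aid A') = F.
Proof. by case: tF => f ->; destruct e; rewrite -pk_comp comp_idr. Qed.

End Arrows.

Arguments arr : clear implicits.
Arguments arrow : clear implicits.
Declare Scope arr_scope.
Delimit Scope arr_scope with arr.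
Bind Scope arr_scope with arr.
Local Open Scope arr_scope.
Notation "G @ F" := (acomp G F) (at level 40, left associativity) : arr_scope.

Section Tensor.

Context {C : strict_monoidal}.

Definition atens (F G : arr C) : arr C :=
  match F, G with
  | Some f, Some g => pk (tensm (amor f) (amor g))
  | _, _ => None
  end.

Local Notation "F ⊠ G" := (atens F G) (at level 38, left associativity) : arr_scope.
Implicit Types F G : arr C.

Lemma pk_tens (A B A' B' : Ob C) (f : Hom A B) (g : Hom A' B') :
  pk (tensm f g) = pk f ⊠ pk g.
Proof. by []. Qed.

Lemma atensA F G K : F ⊠ (G ⊠ K) = F ⊠ G ⊠ K.
Proof.
case: F G K => [[? ? f]|] [[? ? g]|] [[? ? k]|] //.
by apply/mor_eqP/tensmA.
Qed.

Lemma atens1l F : aid tunit ⊠ F = F.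
Proof. by case: F => [[? ? f]|] //; apply/mor_eqP/tensm1o. Qed.

Lemma atens1r F : F ⊠ aid tunit = F.
Proof. by case: F => [[? ? f]|] //; apply/mor_eqP/tensmo1. Qed.

Lemma aid_tens (A B : Ob C) : aid (tens A B) = aid A ⊠ aid B.
Proof. by rewrite -pk_tens tensm_id. Qed.

#[global] Instance typed_tens F G (A B A' B' : Ob C) (tF : typed F A B)
  (tG : typed G A' B') : typed (F ⊠ G) (tens A A') (tens B B').
Proof. by case: tF tG => [f ->] [g ->]; exists (tensm f g). Qed.

Lemma interchange G G' F F' (A B B1 D A' B' B1' D' : Ob C)
  (tF : typed F A B) (tG : typed G B1 D) (e : ob_eq B B1)
  (tF' : typed F' A' B') (tG' : typed G' B1' D') (e' : ob_eq B' B1') :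
  (G ⊠ G') @ (F ⊠ F') = (G @ F) ⊠ (G' @ F').
Proof.
case: tF tG tF' tG' => [f ->] [g ->] [f' ->] [g' ->].
destruct e, e'.
by rewrite -!pk_tens -!pk_comp -pk_tens tensm_comp.
Qed.

End Tensor.

Notation "F ⊠ G" := (atens F G) (at level 38, left associativity) : arr_scope.

Arguments acomp {C} G F : simpl never.
Arguments atens {C} F G : simpl never.

(** * The symmetry *)
Section Symmetry.

Context {C : strict_symmetric_monoidal}.
Implicit Types (F G : arr C) (A B D X Y : Ob C).

Definition asym A B : arr C := pk (sym A B).

#[global] Instance typed_sym A B : typed (asym A B) (tens A B) (tens B A).
Proof. by exists (sym A B). Qed.

Lemma asym_nat F G A A' B B' (tF : typed F A A') (tG : typed G B B') :
  asym A' B' @ (F ⊠ G) = (G ⊠ F) @ asym A B.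
Proof.
case: tF tG => [f ->] [g ->].
by rewrite -!pk_tens -!pk_comp; congr pk; exact: sym_nat.
Qed.

Lemma asymK A B : asym B A @ asym A B = aid A ⊠ aid B.
Proof. by rewrite -aid_tens -pk_comp; congr pk; exact: symK. Qed.

Lemma asym_hexr A B D :
  asym A (tens B D) = (aid B ⊠ asym A D) @ (asym A B ⊠ aid D).
Proof.
by rewrite /asym; have /mor_eqP -> := sym_hex A B D; rewrite pk_scomp.
Qed.

(** The second hexagon is the inverse of the first one. *)
Lemma asym_hexl A B D :
  asym (tens A B) D = (asym A D ⊠ aid B) @ (aid A ⊠ asym B D).
Proof.
set R := RHS.
have RK : asym D (tens A B) @ R = aid (tens A (tens B D)).
  rewrite asym_hexr /R -acompA (acompA _ _ (asym D A ⊠ aid B)).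
  rewrite interchange asymK aidl -!aid_tens aidl.
  by rewrite interchange asymK aidl -!aid_tens.
rewrite -[LHS](@aidr _ _ _ (tens A (tens B D)) _ _ _) -RK acompA.
by rewrite asymK -aid_tens aidl.
Qed.

(** The hexagon for [A] and two copies of the unit makes this map idempotent,
    and it is invertible. *)
Lemma asym1r A : asym A tunit = aid A.
Proof.
have e := asym_hexr A tunit tunit.
rewrite tens1o atens1l atens1r in e.
have := congr1 (acomp (asym tunit A)) e.
rewrite acompA asymK -aid_tens.
by rewrite tenso1 aidl => <-.
Qed.

Lemma asym1l A : asym tunit A = aid A.
Proof.
have := asymK tunit A; rewrite asym1r aidl => ->.
by rewrite atens1l.
Qed.

End Symmetry.

(* Identities must be merged before they can be absorbed, since an identity of
   a tensor product may be composed with a morphism that does not split. *)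
Ltac simp_id :=
  repeat first [rewrite aidl | rewrite aidr | rewrite -aid_tens];
  rewrite ?aid_tens.

(** * The mirror image of a monoidal category *)

(** Reversing the order of tensor products exchanges left and right in every
    diagram, so a statement about the target map of a weak bialgebra, proved in
    all categories, also yields the one about its source map. *)
Section Mirror.
Variable C : strict_symmetric_monoidal.

Definition mirror_sm : strict_monoidal.
Proof.
refine (@StrictMonoidal C (fun A B => tens B A) tunit
  (fun A B A' B' f g => tensm g f) _ _ _ _ _ _ _ _).
- by move=> A B; apply: tensm_id.
- by move=> *; apply: tensm_comp.
- by move=> A B D; rewrite tensA.
- by move=> A; apply: tenso1.
- by move=> A; apply: tens1o.
- by move=> *; apply/mor_eqP/esym/mor_eqP/tensmA.
- by move=> *; apply: tensmo1.
- by move=> *; apply: tensm1o.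
Defined.

Lemma mirror_tens (F G : arr C) : @atens mirror_sm F G = G ⊠ F.
Proof. by case: F G => [?|] [?|]. Qed.

Definition mirror : strict_symmetric_monoidal.
Proof.
refine (@StrictSymmetricMonoidal mirror_sm (fun A B => sym B A) _ _ _).
- by move=> A A' B B' f g; apply: (sym_nat g f).
- by move=> A B; apply: symK.
- move=> A B D; apply/mor_eqP; rewrite pk_scomp (@pk_tens mirror_sm) (@pk_tens mirror_sm).
  by rewrite !mirror_tens; apply: asym_hexl.
Defined.
End Mirror.

(** * Tensor products of cocommutative coalgebras *)
Section TensorCoalgebra.
Context {C : strict_symmetric_monoidal}.

Record ccoalg := CCoalg {
  cc_ob :> Ob C;
  cc_eps : Hom cc_ob tunit;
  cc_delta : Hom cc_ob (tens cc_ob cc_ob);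
  cc_ax : is_coalgebra cc_eps cc_delta;
  cc_comm : scomp (sym cc_ob cc_ob) cc_delta = cc_delta }.

Notation del E := (pk (cc_delta E)).
Notation cou E := (pk (cc_eps E)).

Lemma cc_counitl (E : ccoalg) : (cou E ⊠ aid E) @ del E = aid E.
Proof.
have /mor_eqP := coalg_counitl (cc_ax E).
by rewrite pk_scomp.
Qed.

Lemma cc_counitr (E : ccoalg) : (aid E ⊠ cou E) @ del E = aid E.
Proof.
have /mor_eqP := coalg_counitr (cc_ax E).
by rewrite pk_scomp.
Qed.

Lemma cc_coassoc (E : ccoalg) :
  (del E ⊠ aid E) @ del E = (aid E ⊠ del E) @ del E.
Proof.
have /mor_eqP := coalg_coassoc (cc_ax E).
by rewrite !pk_scomp.
Qed.

Lemma cc_cocomm (E : ccoalg) : asym E E @ del E = del E.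
Proof. by rewrite -[RHS](congr1 (@pk _ _ _) (cc_comm E)) pk_scomp. Qed.

Lemma pk_tens_delta (D E : Ob C) (dD : Hom D (tens D D)) (dE : Hom E (tens E E)) :
  pk (tens_delta dD dE) = (aid D ⊠ asym D E ⊠ aid E) @ (pk dD ⊠ pk dE).
Proof. by rewrite pk_recast pk_scomp. Qed.

Variables D E : ccoalg.
Local Notation d := (aid D). Local Notation e := (aid E).
Local Notation td := ((d ⊠ asym D E ⊠ e) @ (del D ⊠ del E)).

(** Both sides are a permutation applied to the iterated comultiplications of
    [D] and [E].  Naturality moves the symmetries past the comultiplications;
    the hexagons split the permutations that remain into adjacent transpositions,
    two of which act on disjoint strands and commute. *)
Lemma tens_coassoc : (td ⊠ d ⊠ e) @ td = (d ⊠ e ⊠ td) @ td.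
Proof.
have -> : td ⊠ d ⊠ e = (d ⊠ asym D E ⊠ e ⊠ d ⊠ e) @ (del D ⊠ del E ⊠ d ⊠ e).
  by rewrite !interchange !aidl.
have -> : d ⊠ e ⊠ td = (d ⊠ e ⊠ d ⊠ asym D E ⊠ e) @ (d ⊠ e ⊠ del D ⊠ del E).
  rewrite -(atensA (d ⊠ e) d) -(atensA (d ⊠ e) (d ⊠ _)).
  by rewrite -(atensA (d ⊠ e)) interchange; simp_id.
rewrite -!acompA !(acompA (del D ⊠ del E)).
have -> : (del D ⊠ del E ⊠ d ⊠ e) @ (d ⊠ asym D E ⊠ e) =
   (d ⊠ d ⊠ asym D (tens E E) ⊠ e) @ (del D ⊠ d ⊠ del E ⊠ e).
  rewrite -(atensA (del D) (del E) d) -(atensA (del D) d (del E)) !interchange; simp_id.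
  by rewrite asym_nat; simp_id.
have -> : (d ⊠ e ⊠ del D ⊠ del E) @ (d ⊠ asym D E ⊠ e) =
   (d ⊠ asym (tens D D) E ⊠ e ⊠ e) @ (d ⊠ del D ⊠ e ⊠ del E).
  rewrite -(atensA d e) -(atensA d (del D)) -(atensA _ e e) !interchange; simp_id.
  by rewrite -asym_nat; simp_id.
rewrite -!acompA.
have -> : (del D ⊠ d ⊠ del E ⊠ e) @ (del D ⊠ del E) =
    (d ⊠ del D ⊠ e ⊠ del E) @ (del D ⊠ del E).
  by rewrite -(atensA _ (del E) e) -(atensA _ e (del E)) !interchange !cc_coassoc.
rewrite !acompA; congr (_ @ _ @ _).
rewrite asym_hexr asym_hexl.
have -> : d ⊠ d ⊠ ((e ⊠ asym D E) @ (asym D E ⊠ e)) ⊠ e =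
   (d ⊠ d ⊠ e ⊠ asym D E ⊠ e) @ (d ⊠ d ⊠ asym D E ⊠ e ⊠ e).
  by rewrite -(atensA (d ⊠ d) e) -(atensA (d ⊠ d) (asym D E)) !interchange; simp_id.
have -> : d ⊠ ((asym D E ⊠ d) @ (d ⊠ asym D E)) ⊠ e ⊠ e =
   (d ⊠ asym D E ⊠ d ⊠ e ⊠ e) @ (d ⊠ d ⊠ asym D E ⊠ e ⊠ e).
  by rewrite -(atensA d _ d) -(atensA d d) !interchange; simp_id.
rewrite !acompA; congr (_ @ _).
by rewrite -!(atensA _ e d) -!(atensA _ d e) !interchange; simp_id.
Qed.

Lemma tens_counitl : (cou D ⊠ cou E ⊠ d ⊠ e) @ td = d ⊠ e.
Proof.
rewrite acompA.
have -> : (cou D ⊠ cou E ⊠ d ⊠ e) @ (d ⊠ asym D E ⊠ e) =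
   cou D ⊠ d ⊠ cou E ⊠ e.
  rewrite -(atensA _ (cou E)) !interchange; simp_id.
  by rewrite -asym_nat asym1r; simp_id; rewrite !atensA.
by rewrite -(atensA _ (cou E)) interchange !cc_counitl.
Qed.

Lemma tens_counitr : (d ⊠ e ⊠ (cou D ⊠ cou E)) @ td = d ⊠ e.
Proof.
rewrite acompA.
have -> : (d ⊠ e ⊠ (cou D ⊠ cou E)) @ (d ⊠ asym D E ⊠ e) =
   d ⊠ cou D ⊠ (e ⊠ cou E).
  rewrite !atensA -(atensA d e) !interchange; simp_id.
  by rewrite -asym_nat asym1l; simp_id; rewrite !atensA.
by rewrite interchange !cc_counitr.
Qed.

(** The symmetry of [D ⊗ E] with itself splits into four; the middle one cancels
    against the transposition in the comultiplication. *)
Lemma tens_cocomm : asym (tens D E) (tens D E) @ td = td.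
Proof.
rewrite asym_hexl !asym_hexr acompA.
have -> : (d ⊠ asym D E @ asym D D ⊠ e) ⊠ e @ d ⊠ (d ⊠ asym E E @ asym E D ⊠ e)
  @ d ⊠ asym D E ⊠ e = (d ⊠ asym D E ⊠ e) @ (asym D D ⊠ asym E E).
  have -> : d ⊠ (d ⊠ asym E E @ asym E D ⊠ e) = (d ⊠ d ⊠ asym E E) @ (d ⊠ asym E D ⊠ e).
    by rewrite -!(atensA d) !interchange; simp_id.
  rewrite -!acompA !interchange asymK; simp_id.
  have -> : (d ⊠ asym D E @ asym D D ⊠ e) ⊠ e = (d ⊠ asym D E ⊠ e) @ (asym D D ⊠ e ⊠ e).
    by rewrite interchange; simp_id.
  rewrite -acompA; congr (_ @ _).
  by rewrite -!(atensA _ e e) !interchange; simp_id.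
by rewrite -acompA interchange !cc_cocomm.
Qed.

Definition tens_ccoalg : ccoalg.
Proof.
refine (@CCoalg (tens D E) (recast (tensm (cc_eps D) (cc_eps E)))
  (tens_delta (cc_delta D) (cc_delta E)) _ _).
- split; apply/mor_eqP; rewrite !pk_scomp !pk_tens ?pk_tens_delta ?pk_recast -/(aid _) aid_tens.
  + by rewrite atensA; apply: tens_counitl.
  + by rewrite tens_counitr.
  + by rewrite (atensA _ d e) tens_coassoc.
- by apply: pk_inj; rewrite pk_scomp pk_tens_delta; apply: tens_cocomm.
Defined.

End TensorCoalgebra.

Notation del E := (pk (cc_delta E)).
Notation cou E := (pk (cc_eps E)).

(** * Pairing morphisms out of a cocommutative coalgebra *)

(** Cocommutative coalgebras and comultiplicative morphisms behave like sets and
    partial functions: [pair f g] plays the role of e |-> (f e, g e).  Its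
    untyped version [apair] is strictly associative, so a nested pairing can be
    handled as a list of components. *)
Section Pairing.
Context {C : strict_symmetric_monoidal}.
Variable E : ccoalg (C := C).

Definition pair (X Y : Ob C) (f : Hom E X) (g : Hom E Y) : Hom E (tens X Y) :=
  comp (tensm f g) (cc_delta E).

Definition apair (F G : arr C) : arr C := (F ⊠ G) @ del E.

Lemma pk_pair (X Y : Ob C) (f : Hom E X) (g : Hom E Y) :
  pk (pair f g) = apair (pk f) (pk g).
Proof. by rewrite pk_comp. Qed.

#[global] Instance typed_apair F G X Y (tF : typed F E X) (tG : typed G E Y) :
  typed (apair F G) E (tens X Y).
Proof. rewrite /apair; exact _. Qed.

Lemma apairA F G K X Y Z (tF : typed F E X) (tG : typed G E Y)
    (tK : typed K E Z) :
  apair F (apair G K) = apair (apair F G) K.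
Proof.
rewrite /apair -{1}[F]aidr -{2}[K]aidr -!interchange -!acompA cc_coassoc.
by rewrite atensA.
Qed.

Lemma apair_comp A B F G X X1 X2 Y Y1 Y2 (tF : typed F E X) (tG : typed G E Y)
    (tA : typed A X1 X2) (tB : typed B Y1 Y2) (eX : ob_eq X X1) (eY : ob_eq Y Y1) :
  (A ⊠ B) @ apair F G = apair (A @ F) (B @ G).
Proof. by rewrite /apair acompA interchange. Qed.

Lemma apair_sym F G X Y (tF : typed F E X) (tG : typed G E Y) :
  asym X Y @ apair F G = apair G F.
Proof. by rewrite /apair acompA asym_nat -acompA cc_cocomm. Qed.

(** The transposition that occurs in the comultiplication of a tensor product
    exchanges the two middle components. *)
Lemma apair_swap F G K L W X Y Z (tF : typed F E W) (tG : typed G E X)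
    (tK : typed K E Y) (tL : typed L E Z) :
  (aid W ⊠ asym X Y ⊠ aid Z) @ apair (apair F G) (apair K L) =
  apair (apair F K) (apair G L).
Proof.
rewrite !apairA -[apair (apair F G) K]apairA -[apair (apair F K) G]apairA.
by rewrite !apair_comp apair_sym; simp_id.
Qed.

Lemma apair_counitl F X (tF : typed F E X) : apair (cou E) F = F.
Proof.
rewrite /apair -[F]aidr -[cou E](aidl (B' := tunit)) -interchange -acompA.
by rewrite cc_counitl !aidr atens1l.
Qed.

Lemma apair_counitr F X (tF : typed F E X) : apair F (cou E) = F.
Proof.
rewrite /apair -[F]aidr -[cou E](aidl (B' := tunit)) -interchange -acompA.
by rewrite cc_counitr !aidr atens1r.
Qed.

Lemma pair_comp X Y X' Y' (a : Hom X X') (b : Hom Y Y') (f : Hom E X) (g : Hom E Y) :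
  comp (tensm a b) (pair f g) = pair (comp a f) (comp b g).
Proof. by rewrite /pair compA tensm_comp. Qed.

(** Counits are not preserved on purpose: the product of a weak Hopf algebra is
    comultiplicative but not counital, like a partially defined product. *)
Definition comult (D : ccoalg (C := C)) (x : Hom E D) : Prop :=
  comp (cc_delta D) x = pair x x.

End Pairing.

Lemma pair_precomp (C : strict_symmetric_monoidal) (E D : ccoalg (C := C)) X Y
  (f : Hom D X) (g : Hom D Y) (x : Hom E D) : comult x -> comp (pair f g) x = pair (comp f x) (comp g x).
Proof. by move=> hx; rewrite /pair -compA hx pair_comp. Qed.

Lemma comult_comp (C : strict_symmetric_monoidal) (E D D' : ccoalg (C := C)) (y : Hom D D')
  (x : Hom E D) : comult y -> comult x -> comult (comp y x).
Proof. by move=> hy hx; rewrite /comult compA hy pair_precomp. Qed.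

(** This is where cocommutativity of the source is used: the copies of [x] and
    [y] come in the wrong order otherwise. *)
Lemma comult_pair (C : strict_symmetric_monoidal) (E D D' : ccoalg (C := C)) (x : Hom E D)
  (y : Hom E D') : comult x -> comult y ->
  comult (D := tens_ccoalg D D') (pair x y).
Proof.
move=> hx hy; apply: pk_inj; rewrite pk_comp pk_tens_delta !pk_pair -acompA apair_comp.
by rewrite -!pk_comp hx hy !pk_pair apair_swap.
Qed.

Arguments pair {C} E {X Y} f%_mor g%_mor.
Arguments comult {C} E D x%_mor.

(** The projections let a morphism out of [D ⊗ D'] be recovered from its values
    on points, as they pair to the identity. *)
Section Projections.
Context {C : strict_symmetric_monoidal}.
Variables D D' : ccoalg (C := C).
Local Notation DD := (tens_ccoalg D D').

Definition cproj1 : Hom DD D := recast (tensm (idm D) (cc_eps D')).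
Definition cproj2 : Hom DD D' := recast (tensm (cc_eps D) (idm D')).

Lemma pair_cproj : pair DD cproj1 cproj2 = idm DD.
Proof.
apply: pk_inj; rewrite pk_pair !pk_recast !pk_tens /apair pk_tens_delta atensA.
rewrite -[RHS]/(aid (tens D D')) aid_tens acompA.
have -> : (aid D ⊠ cou D' ⊠ cou D ⊠ aid D') @ (aid D ⊠ asym D D' ⊠ aid D') =
  (aid D ⊠ cou D) ⊠ (cou D' ⊠ aid D').
  rewrite -(atensA (aid D)) !interchange -asym_nat asym1l; simp_id.
  by rewrite !atensA.
by rewrite interchange cc_counitl cc_counitr.
Qed.

Lemma comult_cproj1 : comult DD D cproj1.
Proof.
apply: pk_inj; rewrite pk_comp pk_pair !pk_recast !pk_tens /apair pk_tens_delta acompA atensA.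
have -> : (aid D ⊠ cou D' ⊠ aid D ⊠ cou D') @ (aid D ⊠ asym D D' ⊠ aid D') =
  (aid D ⊠ aid D) ⊠ (cou D' ⊠ cou D').
  rewrite -(atensA (aid D)) !interchange -asym_nat asym1r; simp_id.
  by rewrite !atensA.
rewrite interchange; simp_id.
have -> : (cou D' ⊠ cou D') @ del D' = cou D'.
  have -> : cou D' ⊠ cou D' = cou D' @ (cou D' ⊠ aid D').
    by rewrite -{3}[cou D']atens1l interchange; simp_id.
  by rewrite -acompA cc_counitl aidr.
by rewrite -[X in _ @ (_ ⊠ X)]aidl -{1}[del D]atens1r interchange; simp_id.
Qed.

Lemma comult_cproj2 : comult DD D' cproj2.
Proof.
apply: pk_inj; rewrite pk_comp pk_pair !pk_recast !pk_tens /apair pk_tens_delta acompA atensA.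
have -> : (cou D ⊠ aid D' ⊠ cou D ⊠ aid D') @ (aid D ⊠ asym D D' ⊠ aid D') =
  (cou D ⊠ cou D) ⊠ (aid D' ⊠ aid D').
  rewrite -(atensA (cou D)) !interchange -asym_nat asym1l; simp_id.
  by rewrite !atensA.
rewrite interchange; simp_id.
have -> : (cou D ⊠ cou D) @ del D = cou D.
  have -> : cou D ⊠ cou D = cou D @ (cou D ⊠ aid D).
    by rewrite -{3}[cou D]atens1l interchange; simp_id.
  by rewrite -acompA cc_counitl aidr.
by rewrite -{1}[del D']atens1l interchange; simp_id.
Qed.
End Projections.

(** * The target map of a cocommutative weak bialgebra *)

(** Left and right play the same part in these axioms, so they hold in a category
    as soon as they hold in its mirror image. *)
Record weak_bialgebra (C : strict_symmetric_monoidal) (H : Ob C)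
  (eta : Hom tunit H) (mu : Hom (tens H H) H)
  (eps : Hom H tunit) (delta : Hom H (tens H H)) : Prop := WeakBialgebra {
  wb_unitl : pk mu @ (pk eta ⊠ aid H) = aid H;
  wb_unitr : pk mu @ (aid H ⊠ pk eta) = aid H;
  wb_assoc : pk mu @ (pk mu ⊠ aid H) = pk mu @ (aid H ⊠ pk mu);
  wb_counitl : (pk eps ⊠ aid H) @ pk delta = aid H;
  wb_counitr : (aid H ⊠ pk eps) @ pk delta = aid H;
  wb_coassoc : (pk delta ⊠ aid H) @ pk delta = (aid H ⊠ pk delta) @ pk delta;
  wb_cocomm : asym H H @ pk delta = pk delta;
  wb_deltamu : pk delta @ pk mu =
    (pk mu ⊠ pk mu) @ (aid H ⊠ asym H H ⊠ aid H) @ (pk delta ⊠ pk delta);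
  wb_epsmu : pk eps @ pk mu @ (pk mu ⊠ aid H) =
    ((pk eps @ pk mu) ⊠ (pk eps @ pk mu)) @ (aid H ⊠ pk delta ⊠ aid H);
  wb_deltaeta : (pk delta ⊠ aid H) @ (pk delta @ pk eta) =
    (aid H ⊠ pk mu ⊠ aid H) @ ((pk delta @ pk eta) ⊠ (pk delta @ pk eta)) }.

(** In Sweedler notation, [1H] is 1_1 ⊗ 1_2, and [target] is called Pi. *)
Section WeakBialgebra.
Context {C : strict_symmetric_monoidal}.
Variables (H : Ob C) (eta : Hom tunit H) (mu : Hom (tens H H) H)
  (eps : Hom H tunit) (delta : Hom H (tens H H)).
Hypothesis wb : weak_bialgebra eta mu eps delta.

Local Notation h := (aid H).
Local Notation m := (pk mu).
Local Notation d := (pk delta).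
Local Notation i := (pk eta).
Local Notation u := (pk eps).
Local Notation c := (asym H H).
Local Notation "1H" := (d @ i).

(** Pi(h) = 1_1 eps(1_2 h).  By cocommutativity this is the usual target map
    eps(1_1 h) 1_2, but it is drawn without any crossing of strands.  The
    arguments below are then planar: the crossing in the multiplicativity of the
    comultiplication is carried along as a block, and only the last step of
    [delta_target] uses a symmetry. *)
Definition target : arr C := (h ⊠ (u @ m)) @ (1H ⊠ h).

#[local] Instance typed_target : typed target H H.
Proof. exact: (typed_cast (F := target) _ _ _). Qed.

Lemma deltamu_unitl : (m ⊠ m) @ (h ⊠ c ⊠ h) @ (1H ⊠ d) = d.
Proof.
have -> : 1H ⊠ d = (d ⊠ d) @ (i ⊠ h) by rewrite interchange aidr.
by rewrite acompA -(wb_deltamu wb) -acompA (wb_unitl wb) aidr.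
Qed.

Lemma deltamu_unitr : (m ⊠ m) @ (h ⊠ c ⊠ h) @ (d ⊠ 1H) = d.
Proof.
have -> : d ⊠ 1H = (d ⊠ d) @ (h ⊠ i) by rewrite interchange aidr.
by rewrite acompA -(wb_deltamu wb) -acompA (wb_unitr wb) aidr.
Qed.

(** Pi(h_1) ⊗ h_2 = 1_1 ⊗ 1_2 h.  Starting from the right, insert a counit on the
    second factor: 1_1 ⊗ eps(1_2 h_1) 1_3 h_2.  The axiom on the unit turns this
    into 1_1 ⊗ eps(1_2 1'_1 h_1) 1'_2 h_2, and 1'_1 h_1 ⊗ 1'_2 h_2 is the
    coproduct of h. *)
Lemma target_delta : (target ⊠ h) @ d = (h ⊠ m) @ (1H ⊠ h).
Proof.
have e1 : m = (u ⊠ h) @ d @ m by rewrite (wb_counitl wb) aidl.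
rewrite [in RHS]e1 -(acompA m d) (wb_deltamu wb) -(acompA (d ⊠ d)) acompA interchange aidl.
pose K := ((u @ m) ⊠ m) @ (h ⊠ c ⊠ h).
have -> : ((u @ m) ⊠ m) @ ((h ⊠ c ⊠ h) @ (d ⊠ d)) = K @ (d ⊠ d) by rewrite acompA.
(* Associativity moves the product of 1_2 and 1'_1 to 1'_1 and h_1. *)
have KE : K @ (m ⊠ h ⊠ h ⊠ h) = ((u @ m) ⊠ h) @ (h ⊠ ((m ⊠ m) @ (h ⊠ c ⊠ h))).
  have -> : (m ⊠ h ⊠ h ⊠ h) = m ⊠ (h ⊠ h) ⊠ h by rewrite !atensA.
  rewrite /K -acompA !interchange; simp_id.
  have -> : m ⊠ c ⊠ h = (m ⊠ (h ⊠ h) ⊠ h) @ (h ⊠ h ⊠ c ⊠ h) by rewrite !interchange; simp_id.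
  have -> : m ⊠ (h ⊠ h) ⊠ h = (m ⊠ h) ⊠ (h ⊠ h) by rewrite !atensA.
  rewrite acompA interchange -(acompA _ m u) (wb_assoc wb); simp_id.
  have -> : h ⊠ (m ⊠ m @ h ⊠ c ⊠ h) = (h ⊠ m ⊠ m) @ (h ⊠ h ⊠ c ⊠ h).
    by rewrite -!(atensA h) [in RHS]interchange aidl.
  by rewrite [in RHS]acompA [in RHS]interchange aidl acompA.
have -> : (h ⊠ (K @ (d ⊠ d))) @ (1H ⊠ h) = (h ⊠ (K @ (m ⊠ h ⊠ h ⊠ h))) @ (1H ⊠ 1H ⊠ d).
  have -> : h ⊠ (K @ (d ⊠ d)) = (h ⊠ K) @ (h ⊠ d ⊠ d) by rewrite -atensA interchange aidl.
  rewrite -acompA interchange aidr acompA -(wb_coassoc wb) -acompA (wb_deltaeta wb).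
  have -> : h ⊠ (K @ (m ⊠ h ⊠ h ⊠ h)) = (h ⊠ K) @ (h ⊠ m ⊠ h ⊠ (h ⊠ h)).
    by rewrite -!(atensA h) interchange aidl !atensA.
  rewrite -acompA; congr (_ @ _).
  by rewrite interchange -aid_tens aidl.
rewrite KE.
have -> : h ⊠ (((u @ m) ⊠ h) @ (h ⊠ (m ⊠ m @ h ⊠ c ⊠ h))) =
  (h ⊠ (u @ m) ⊠ h) @ ((h ⊠ h) ⊠ (m ⊠ m @ h ⊠ c ⊠ h)).
  rewrite -!(atensA h).
  by rewrite interchange aidl.
rewrite -acompA -(atensA _ _ d) interchange deltamu_unitl; simp_id.
have -> : 1H ⊠ d = (1H ⊠ h ⊠ h) @ d.
  by rewrite -(atensA 1H h h) -[X in _ = _ @ X]atens1l interchange aidr; simp_id.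
by rewrite acompA interchange aidl.
Qed.

(** eps(g 1_1) eps(1_2 h) = eps(g 1 h) is the axiom on the counit of a product,
    with the unit in the middle. *)
Lemma counit_target : u @ m @ (h ⊠ target) = u @ m.
Proof.
rewrite /target.
have -> : h ⊠ ((h ⊠ (u @ m)) @ (1H ⊠ h)) = (h ⊠ h ⊠ (u @ m)) @ (h ⊠ d ⊠ h) @ (h ⊠ i ⊠ h).
  by rewrite -acompA -!(atensA h) [in RHS]interchange [in RHS]interchange interchange; simp_id.
rewrite !acompA.
have -> : u @ m @ (h ⊠ h ⊠ (u @ m)) = (u @ m) ⊠ (u @ m).
  by rewrite -{1}[u @ m]atens1r interchange; simp_id.
rewrite -(wb_epsmu wb) -!acompA interchange.
by rewrite (wb_unitr wb) aidl; simp_id.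
Qed.

Lemma target_mul : target @ m @ (h ⊠ target) = target @ m.
Proof.
have e F (tF : typed F (tens H H) H) : target @ F = (h ⊠ (u @ m @ (h ⊠ F))) @ (1H ⊠ h ⊠ h).
  rewrite /target -acompA.
  have -> : (1H ⊠ h) @ F = (h ⊠ h ⊠ F) @ (1H ⊠ h ⊠ h).
    by rewrite -{1}[F]atens1l interchange -(atensA 1H) interchange; simp_id.
  by rewrite acompA -atensA interchange aidl.
rewrite -acompA !e; congr (_ @ _); congr (_ ⊠ _).
have -> : h ⊠ (m @ (h ⊠ target)) = (h ⊠ m) @ (h ⊠ h ⊠ target).
  by rewrite -atensA interchange aidl.
rewrite [LHS]acompA -[in LHS](acompA _ m u) -[in RHS](acompA _ m u) -(wb_assoc wb).
have mT : (m ⊠ h) @ (h ⊠ h ⊠ target) = (h ⊠ target) @ (m ⊠ h) by rewrite !interchange; simp_id.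
by rewrite -!acompA mT !acompA counit_target.
Qed.

(** Applying the counit to the last strand recovers [F]. *)
Lemma wb_counitr_inj F G X (tF : typed F H X) (tG : typed G H X) :
  (F ⊠ h) @ d = (G ⊠ h) @ d -> F = G.
Proof.
have k K (tK : typed K H X) : (aid X ⊠ u) @ ((K ⊠ h) @ d) = K.
  rewrite acompA interchange aidl aidr.
  have -> : K ⊠ u = K @ (h ⊠ u) by rewrite -{2}[K]atens1r interchange; simp_id.
  by rewrite -acompA (wb_counitr wb) aidr.
by move=> e; rewrite -(k F) e k.
Qed.

(** Comparing the values of both sides at h_1, paired with h_2: by
    [target_delta] the left one is 1_1 ⊗ 1_2 ⊗ 1_3 h, which the axiom on the
    unit rewrites as 1_1 ⊗ 1_2 1'_1 ⊗ 1'_2 h = 1_1 ⊗ 1_2 Pi(h_1) ⊗ h_2. *)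
Lemma delta_target_split :
  d @ target = (h ⊠ m) @ (1H ⊠ target) /\ d @ target = (target ⊠ h) @ d @ target.
Proof.
suff e1 : d @ target = (h ⊠ m) @ (1H ⊠ target).
  split=> //; rewrite target_delta {1}e1.
  by rewrite -acompA; congr (_ @ _); rewrite -[X in _ = _ @ X]atens1l interchange; simp_id.
apply: (wb_counitr_inj (X := tens H H) _ (typed_cast (A := tens tunit H) _ _ _)).
have -> : (d @ target) ⊠ h = (d ⊠ h) @ (target ⊠ h) by rewrite interchange aidl.
rewrite -acompA target_delta.
have -> : (d ⊠ h) @ (h ⊠ m @ 1H ⊠ h) = (h ⊠ h ⊠ m) @ (((d ⊠ h) @ 1H) ⊠ h).
  have -> : ((d ⊠ h) @ 1H) ⊠ h = (d ⊠ h ⊠ h) @ (1H ⊠ h) by rewrite interchange aidl.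
  by rewrite [LHS]acompA [RHS]acompA -(atensA d) !interchange; simp_id.
rewrite (wb_deltaeta wb).
have -> : ((h ⊠ m ⊠ h) @ (1H ⊠ 1H)) ⊠ h = (h ⊠ m ⊠ h ⊠ h) @ (1H ⊠ 1H ⊠ h).
  by rewrite interchange aidl.
have -> : (h ⊠ h ⊠ m) @ ((h ⊠ m ⊠ h ⊠ h) @ (1H ⊠ 1H ⊠ h)) =
   (h ⊠ m ⊠ h) @ (1H ⊠ ((h ⊠ m) @ (1H ⊠ h))).
  have -> : 1H ⊠ ((h ⊠ m) @ (1H ⊠ h)) = (h ⊠ h ⊠ h ⊠ m) @ (1H ⊠ 1H ⊠ h).
    by rewrite -(atensA (h ⊠ h)) -(atensA 1H) interchange; simp_id.
  rewrite !acompA; congr (_ @ _).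
  by rewrite -!(atensA _ h h) !interchange; simp_id.
rewrite -target_delta.
have -> : 1H ⊠ ((target ⊠ h) @ d) = (1H ⊠ target ⊠ h) @ d.
  by rewrite -[X in _ = _ @ X]atens1l -(atensA 1H) interchange; simp_id.
by rewrite acompA interchange; simp_id.
Qed.

(** By the first form of [delta_target_split] and [target_mul], applying Pi to
    the second factor of the coproduct of Pi(h) gives 1_1 ⊗ Pi(1_2 h), which is
    Pi(h_1) ⊗ Pi(h_2).  By the second form and cocommutativity, Pi fixes this
    second factor. *)
Lemma delta_target : d @ target = (target ⊠ target) @ d.
Proof.
have [e1 e2] := delta_target_split.
have e3 : (h ⊠ target) @ (d @ target) = (target ⊠ target) @ d.
  rewrite e1 acompA interchange aidl.
  have -> : 1H ⊠ target = (h ⊠ h ⊠ target) @ (1H ⊠ h).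
    by rewrite interchange; simp_id.
  rewrite acompA -(atensA h) interchange target_mul -[h @ h]aidl -interchange -acompA.
  by rewrite ?aidl -target_delta acompA interchange aidl aidr.
have e4 : c @ (d @ target) = d @ target by rewrite acompA (wb_cocomm wb).
by rewrite -e3 -[in RHS]e4 acompA -asym_nat -acompA [_ @ (d @ _)]acompA -e2 e4.
Qed.

End WeakBialgebra.

Lemma weak_bialgebra_mirror (C : strict_symmetric_monoidal) (H : Ob C)
  (eta : Hom tunit H) (mu : Hom (tens H H) H)
  (eps : Hom H tunit) (delta : Hom H (tens H H)) :
  weak_bialgebra eta mu eps delta ->
  @weak_bialgebra (mirror C) H eta mu eps delta.
Proof.
move=> wb; split; rewrite ?(@mirror_tens C).
- exact: wb_unitr wb.
- exact: wb_unitl wb.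
- by rewrite (wb_assoc wb).
- exact: wb_counitr wb.
- exact: wb_counitl wb.
- by rewrite (wb_coassoc wb).
- exact: wb_cocomm wb.
- by rewrite (wb_deltamu wb) atensA.
- by rewrite atensA -(wb_epsmu wb) -!acompA (wb_assoc wb).
- by rewrite atensA -(wb_deltaeta wb) !acompA (wb_coassoc wb).
Qed.

(** The source map is the target map of the mirror image. *)
Lemma delta_source (C : strict_symmetric_monoidal) (H : Ob C)
  (eta : Hom tunit H) (mu : Hom (tens H H) H)
  (eps : Hom H tunit) (delta : Hom H (tens H H)) (source : arr C) :
  weak_bialgebra eta mu eps delta ->
  source = ((pk eps @ pk mu) ⊠ aid H) @ (aid H ⊠ (pk delta @ pk eta)) ->
  pk delta @ source = (source ⊠ source) @ pk delta.
Proof.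
move=> wb ->; have := delta_target (weak_bialgebra_mirror wb).
by rewrite /target ?(@mirror_tens C).
Qed.

(** * The antipode is comultiplicative *)
Section Antipode.
Context {C : strict_symmetric_monoidal}.
Variables (H : weak_hopf C) (Hco : cocommutative H).

Local Notation h := (aid H).
Local Notation m := (pk (wh_mu H)).
Local Notation d := (pk (wh_delta H)).
Local Notation i := (pk (wh_eta H)).
Local Notation u := (pk (wh_eps H)).
Local Notation l := (pk (wh_lambda H)).
Local Notation c := (asym H H).
Local Notation "1H" := (d @ i).

Lemma weak_hopf_bialgebra :
  weak_bialgebra (wh_eta H) (wh_mu H) (wh_eps H) (wh_delta H).
Proof.
have [[a1 a2 a3] [c1 c2 c3] b1 b2 _ b3 _ _ _ _] := wh_ax H.
move/mor_eqP: a1 a2 a3 => a1 /mor_eqP a2 /mor_eqP a3.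
move/mor_eqP: c1 c2 c3 => c1 /mor_eqP c2 /mor_eqP c3.
move/mor_eqP: b2 b3 => b2 /mor_eqP b3.
have {}b1 := congr1 (@pk _ _ _) b1.
rewrite !pk_scomp !pk_tens ?pk_scomp ?pk_tens_delta -/(aid _) in a1 a2 a3 c1 c2 c3 b1 b2 b3.
split=> //.
- by rewrite -pk_scomp Hco.
- by rewrite b1 acompA.
- by rewrite acompA b3.
Qed.

Definition wh_ccoalg : ccoalg (C := C) := CCoalg (wh_coalg (wh_ax H)) Hco.

Local Notation wb := weak_hopf_bialgebra.

Lemma unit_cocomm : c @ 1H = 1H.
Proof. by rewrite acompA (wb_cocomm wb). Qed.

(** Cocommutativity of the coproduct of the unit removes the crossing in the
    definition of the target map. *)
Lemma PiLE : pk (PiL H) = target (wh_eta H) (wh_mu H) (wh_eps H) (wh_delta H).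
Proof.
rewrite pk_recast !pk_scomp !pk_tens !pk_scomp -/(aid _) -/(asym _ _).
rewrite -[X in _ @ (X ⊠ h)]unit_cocomm.
have -> : (c @ 1H) ⊠ h = (c ⊠ h) @ (1H ⊠ h) by rewrite interchange aidl.
rewrite acompA -(acompA _ (h ⊠ c)) -asym_hexr -asym_nat asym1r.
by simp_id.
Qed.

Lemma PiRE : pk (PiR_of (wh_eta H) (wh_mu H) (wh_eps H) (wh_delta H)) =
  ((u @ m) ⊠ h) @ (h ⊠ 1H).
Proof.
rewrite pk_recast !pk_scomp !pk_tens !pk_scomp -/(aid _) -/(asym _ _).
rewrite -[X in _ @ (h ⊠ X)]unit_cocomm.
have -> : h ⊠ (c @ 1H) = (h ⊠ c) @ (h ⊠ 1H) by rewrite interchange aidl.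
rewrite acompA -(acompA _ (c ⊠ h)) -asym_hexl -asym_nat asym1l.
by simp_id.
Qed.

(** The product of the algebra [H ⊗ H]. *)
Definition mu2 : arr C := (m ⊠ m) @ (h ⊠ c ⊠ h).

#[local] Instance typed_mu2 : typed mu2 (tens (tens H H) (tens H H)) (tens H H).
Proof. exact: (typed_cast (F := mu2) _ _ _). Qed.

(** Dual to [tens_coassoc], with the same permutations. *)
Lemma mu2_assoc : mu2 @ (mu2 ⊠ (h ⊠ h)) = mu2 @ ((h ⊠ h) ⊠ mu2).
Proof.
have assoc := wb_assoc wb.
have -> : mu2 ⊠ (h ⊠ h) = (m ⊠ m ⊠ h ⊠ h) @ (h ⊠ c ⊠ h ⊠ h ⊠ h).
  by rewrite -!(atensA _ h h) interchange; simp_id.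
have -> : (h ⊠ h) ⊠ mu2 = (h ⊠ h ⊠ m ⊠ m) @ (h ⊠ h ⊠ h ⊠ c ⊠ h).
  by rewrite -(atensA (h ⊠ h) m) -(atensA (h ⊠ h) h) -(atensA (h ⊠ h)) interchange; simp_id.
have -> : mu2 @ ((m ⊠ m ⊠ h ⊠ h) @ (h ⊠ c ⊠ h ⊠ h ⊠ h)) =
   (m ⊠ m) @ (m ⊠ h ⊠ (m ⊠ h)) @ (h ⊠ h ⊠ asym (tens H H) H ⊠ h) @ (h ⊠ c ⊠ h ⊠ h ⊠ h).
  rewrite /mu2 !acompA; congr (_ @ _).
  rewrite -!acompA; congr (_ @ _).
  rewrite !atensA -(atensA m m h) -(atensA m h m) !interchange.
  by rewrite asym_nat; simp_id.
have -> : mu2 @ ((h ⊠ h ⊠ m ⊠ m) @ (h ⊠ h ⊠ h ⊠ c ⊠ h)) =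
   (m ⊠ m) @ (h ⊠ m ⊠ (h ⊠ m)) @ (h ⊠ asym H (tens H H) ⊠ h ⊠ h) @ (h ⊠ h ⊠ h ⊠ c ⊠ h).
  rewrite /mu2 !acompA; congr (_ @ _).
  rewrite -!acompA; congr (_ @ _).
  rewrite !atensA -(atensA h h m) -(atensA h m h) -(atensA _ h h) !interchange.
  by rewrite asym_nat; simp_id.
rewrite !interchange assoc -!acompA; congr (_ @ _).
rewrite asym_hexr asym_hexl.
have -> : h ⊠ h ⊠ (c ⊠ h @ h ⊠ c) ⊠ h = (h ⊠ h ⊠ c ⊠ h ⊠ h) @ (h ⊠ h ⊠ h ⊠ c ⊠ h).
  by rewrite -(atensA (h ⊠ h) c) -(atensA (h ⊠ h) h) !interchange; simp_id.
have -> : h ⊠ (h ⊠ c @ c ⊠ h) ⊠ h ⊠ h = (h ⊠ h ⊠ c ⊠ h ⊠ h) @ (h ⊠ c ⊠ h ⊠ h ⊠ h).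
  by rewrite -(atensA h h c) -(atensA h c h) !interchange; simp_id.
rewrite -!acompA; congr (_ @ _).
by rewrite -!(atensA h h h) -!(atensA (h ⊠ c) h h) !interchange; simp_id.
Qed.

Local Notation E := wh_ccoalg.
Local Notation ap := (apair wh_ccoalg).

Lemma apair_assoc (E0 : ccoalg (C := C)) M A (tM : typed M (tens A A) A)
   F G K (tF : typed F E0 A) (tG : typed G E0 A) (tK : typed K E0 A) :
  M @ (M ⊠ aid A) = M @ (aid A ⊠ M) ->
  M @ apair E0 (M @ apair E0 F G) K = M @ apair E0 F (M @ apair E0 G K).
Proof.
move=> e.
rewrite -{2}[F]aidl -{1}[K]aidl -!apair_comp [LHS]acompA e.
by rewrite -[LHS]acompA apairA.
Qed.

Lemma mu2_pair (E0 : ccoalg (C := C)) F F' G G'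
    (tF : typed F E0 H) (tF' : typed F' E0 H) (tG : typed G E0 H) (tG' : typed G' E0 H) :
  mu2 @ apair E0 (apair E0 F F') (apair E0 G G') =
  apair E0 (m @ apair E0 F G) (m @ apair E0 F' G').
Proof.
by rewrite /mu2 -acompA apair_swap apair_comp.
Qed.

(** In the convolution algebra of morphisms from [H] to [H ⊗ H], both the
    coproduct of the antipode and [lambda ⊗ lambda] applied to the coproduct are
    inverse to the coproduct in the weak sense: their products with it are the
    coproducts of the target and source maps, by [delta_target] and
    [delta_source], and each absorbs these products.  So they coincide. *)
Lemma comult_antipode : comult E E (wh_lambda H).
Proof.
have [_ _ _ _ _ _ _ a4 a5 a6] := wh_ax H.
have {}a4 := congr1 (@pk _ _ _) a4; have {}a5 := congr1 (@pk _ _ _) a5.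
have {}a6 := congr1 (@pk _ _ _) a6.
rewrite /conv !pk_scomp !pk_tens !pk_scomp !pk_tens -/(aid _) in a4 a5 a6.
rewrite -!(acompA d) in a4 a5 a6.
rewrite a5 in a6; rewrite -!/(apair E _ _) in a4 a5 a6.
set R := pk (PiR_of _ _ _ _) in a5 a6.
have dR : d @ R = ap R R by exact: (delta_source wb PiRE).
have dP : d @ pk (PiL H) = ap (pk (PiL H)) (pk (PiL H)).
  by rewrite PiLE; exact: (delta_target wb).
have dhh : d = ap h h by rewrite /apair; simp_id.
have dM F G (tF : typed F H H) (tG : typed G H H) : mu2 @ ap (d @ F) (d @ G) = d @ (m @ ap F G).
  by rewrite -apair_comp [RHS]acompA (wb_deltamu wb) -[RHS]acompA.
apply: pk_inj; rewrite pk_comp pk_pair -[LHS]/(d @ l).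
have dh : d = d @ h by rewrite aidr.
have e1 : mu2 @ ap d (d @ l) = mu2 @ ap d (ap l l).
  by rewrite [in RHS]dhh mu2_pair a4 -dP [X in ap X _]dh dM a4.
have e2 : mu2 @ ap (d @ l) d = mu2 @ ap (ap l l) d.
  by rewrite [in RHS]dhh mu2_pair a5 -dR [X in ap _ X]dh dM a5.
rewrite -{1}a6 -dM -a5 -dM -dh.
have mA : mu2 @ (mu2 ⊠ aid (tens H H)) = mu2 @ (aid (tens H H) ⊠ mu2).
  by rewrite aid_tens mu2_assoc.
rewrite e2 apair_assoc // e1 -apair_assoc // [X in ap (_ @ ap _ X)]dhh.
by rewrite !mu2_pair a5 a6.
Qed.

End Antipode.

(** * The calculus of points *)
Section Points.
Context {C : strict_symmetric_monoidal}.
Variables (H : weak_hopf C) (Hco : cocommutative H).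
Variables (B : algebra C) (phi : Hom (tens H B) B).
Hypothesis Bw : is_weak_module_algebra phi.

Local Notation h := (aid H).
Local Notation m := (pk (wh_mu H)).
Local Notation d := (pk (wh_delta H)).
Local Notation i := (pk (wh_eta H)).
Local Notation c := (asym H H).
Local Notation "1H" := (d @ i).
Local Notation b := (aid B).
Local Notation mB := (pk (alg_mu B)).
Local Notation iB := (pk (alg_eta B)).
Local Notation ph := (pk phi).
Local Notation P := (pk (PiL H)).
Local Notation v := (pk (u1 phi)).
Local Notation cH := (wh_ccoalg Hco).
Local Notation wb := (weak_hopf_bialgebra Hco).

Lemma phi_mul : ph @ (h ⊠ mB) =
  mB @ (ph ⊠ ph) @ (h ⊠ asym H B ⊠ b) @ (d ⊠ b ⊠ b).
Proof.
have /mor_eqP := wma_b1 Bw.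
by rewrite !pk_scomp.
Qed.

Lemma phi_unit : ph @ (i ⊠ b) = b.
Proof.
have /mor_eqP := wma_b2 Bw.
by rewrite !pk_scomp.
Qed.

Lemma u1_mul : v @ m = ph @ (h ⊠ v).
Proof.
have := congr1 (@pk _ _ _) (wma_b3 Bw).
by rewrite !pk_scomp.
Qed.

Lemma u1E : v = ph @ (h ⊠ iB).
Proof. by rewrite pk_recast pk_scomp. Qed.

Section Source.
Variable E : ccoalg (C := C).
Local Notation ap := (apair E).
Local Notation comult := (comult E cH).

Definition pmul (x y : Hom E H) : Hom E H := comp (wh_mu H) (pair E x y).
Definition cmul (f g : Hom E B) : Hom E B := comp (alg_mu B) (pair E f g).
Definition act (x : Hom E H) (f : Hom E B) : Hom E B := comp phi (pair E x f).
(** The unit of the convolution monoid of morphisms from [E] to [B]. *)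
Definition cone : Hom E B := comp (alg_eta B) (cc_eps E).
Definition act1 (x : Hom E H) : Hom E B := act x cone.
Definition tgt (x : Hom E H) : Hom E H := comp (PiL H) x.

Lemma pk_pmul x y : pk (pmul x y) = m @ ap (pk x) (pk y).
Proof. by rewrite pk_comp pk_pair. Qed.

Lemma pk_cmul f g : pk (cmul f g) = mB @ ap (pk f) (pk g).
Proof. by rewrite pk_comp pk_pair. Qed.

Lemma pk_act x f : pk (act x f) = ph @ ap (pk x) (pk f).
Proof. by rewrite pk_comp pk_pair. Qed.

Lemma pk_act1 x : pk (act1 x) = v @ pk x.
Proof.
rewrite pk_act pk_comp -{1}(aidl (F := pk x) (B' := H)) -apair_comp.
by rewrite apair_counitr acompA u1E.
Qed.

Lemma comult_mul x y : comult x -> comult y -> comult (pmul x y).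
Proof.
move=> hx hy; apply: (comult_comp (D := tens_ccoalg cH cH)) (comult_pair hx hy).
apply: pk_inj; rewrite pk_comp (wb_deltamu wb) pk_pair /apair pk_tens_delta.
by rewrite acompA.
Qed.

Lemma comult_tgt x : comult x -> comult (tgt x).
Proof.
apply: (comult_comp (D := cH)); apply: pk_inj.
by rewrite pk_comp pk_pair (PiLE Hco); exact: (delta_target wb).
Qed.

Lemma comult_lambda x : comult x -> comult (comp (wh_lambda H) x).
Proof. by apply: (comult_comp (D := cH)); exact: comult_antipode. Qed.

Lemma pmulA x y z : pmul x (pmul y z) = pmul (pmul x y) z.
Proof.
apply: pk_inj; rewrite !pk_pmul apair_assoc //.
exact: (wb_assoc wb).
Qed.

Lemma cmulA f g k : cmul f (cmul g k) = cmul (cmul f g) k.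
Proof.
apply: pk_inj; rewrite !pk_cmul apair_assoc //.
have /mor_eqP := alg_assoc (alg_ax B).
by rewrite !pk_scomp !pk_tens.
Qed.

Lemma cmul1l f : cmul cone f = f.
Proof.
apply: pk_inj; rewrite pk_cmul pk_comp -{1}[pk f](aidl (B' := B)) -apair_comp.
have /mor_eqP := alg_unitl (alg_ax B); rewrite pk_scomp acompA => ->.
by rewrite apair_counitl aidl.
Qed.

Lemma cmul1r f : cmul f cone = f.
Proof.
apply: pk_inj; rewrite pk_cmul pk_comp -{1}[pk f](aidl (B' := B)) -apair_comp.
have /mor_eqP := alg_unitr (alg_ax B); rewrite pk_scomp acompA => ->.
by rewrite apair_counitr aidl.
Qed.

Lemma pmul_antipode x : comult x -> pmul x (comp (wh_lambda H) x) = tgt x.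
Proof.
move=> hx; rewrite /tgt /pmul.
have [_ _ _ _ _ _ _ a4 _ _] := wh_ax H.
rewrite -[PiL H]a4 -{1}[x]comp_idl -(pair_precomp (D := cH)) //.
by rewrite /conv /pair !compA.
Qed.

Lemma act_act1 x y : act x (act1 y) = act1 (pmul x y).
Proof.
apply: pk_inj; rewrite pk_act1 pk_act pk_pmul pk_act1.
by rewrite [RHS]acompA u1_mul -acompA apair_comp aidl.
Qed.

(** The action axiom duplicates the acting element, and a point turns this into
    two copies of itself. *)
Lemma act_mul x f g : comult x -> act x (cmul f g) = cmul (act x f) (act x g).
Proof.
move=> hx; apply: pk_inj; rewrite pk_act !pk_cmul !pk_act.
rewrite -{1}[pk x]aidl -apair_comp [LHS]acompA phi_mul -!acompA; congr (_ @ _).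
rewrite -(atensA d) apair_comp -aid_tens aidl -pk_comp hx pk_pair.
by rewrite apair_swap apair_comp.
Qed.

(** f g = 1 ▷ (f g) = (1_1 ▷ f) (1_2 ▷ g). *)
Lemma pk_cmul_unit f g :
  pk (cmul f g) = mB @ (ph ⊠ ph) @ (h ⊠ asym H B ⊠ b) @ ap (1H @ cou E) (ap (pk f) (pk g)).
Proof.
have e : mB = ph @ (h ⊠ mB) @ (i ⊠ b ⊠ b).
  rewrite -acompA -(atensA i) interchange; simp_id.
  have -> : i ⊠ mB = (i ⊠ b) @ mB by rewrite -[X in _ = _ @ X]atens1l interchange; simp_id.
  by rewrite acompA phi_unit aidl.
rewrite pk_cmul [X in X @ _]e phi_mul -!acompA; congr (_ @ _); congr (_ @ _); congr (_ @ _).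
rewrite -(atensA i) -(atensA d) -[X in _ @ (_ @ X)](apair_counitl (E := E)).
by do 2 rewrite apair_comp -?aid_tens ?aidl.
Qed.

(** [target_delta] on a point; 1_1 ⊗ 1_2 stays a morphism out of the unit object
    here, and a constant over [E] in [tgt_pair]. *)
Lemma tgt_pair_split y : comult y ->
  ap (pk (tgt y)) (pk y) = (h ⊠ m) @ (1H ⊠ h) @ pk y.
Proof.
move=> hy.
have -> : ap (pk (tgt y)) (pk y) = (P ⊠ h) @ d @ pk y.
  by rewrite -acompA -pk_comp hy pk_pair apair_comp pk_comp aidl.
by rewrite (PiLE Hco) (target_delta wb).
Qed.

Lemma tgt_pair y : comult y ->
  (h ⊠ m) @ ap (1H @ cou E) (pk y) = ap (pk (tgt y)) (pk y).
Proof.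
move=> hy; rewrite tgt_pair_split // -[RHS]acompA; congr (_ @ _).
by rewrite -[X in _ = _ @ X](apair_counitl (E := E)) apair_comp aidl.
Qed.

(** f (x ▷ 1) = (1_1 ▷ f) (1_2 ▷ x ▷ 1) = (1_1 ▷ f) (1_2 x ▷ 1), and
    1_1 ⊗ 1_2 x = Pi(x_1) ⊗ x_2. *)
Lemma cmul_act1_tgt f x : comult x -> cmul f (act1 x) = cmul (act (tgt x) f) (act1 x).
Proof.
move=> hx; apply: pk_inj; rewrite pk_cmul_unit pk_cmul pk_act !pk_act1.
set Z := 1H @ cou E.
rewrite -!acompA; congr (_ @ _).
have -> : ap Z (ap (pk f) (v @ pk x)) =
  (h ⊠ h ⊠ ((b ⊠ v) @ asym H B)) @ ap Z (ap (pk x) (pk f)).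
  by rewrite apair_comp -acompA apair_sym apair_comp; simp_id.
have e2 : (ph ⊠ ph) @ (h ⊠ asym H B ⊠ b) @ (h ⊠ h ⊠ ((b ⊠ v) @ asym H B)) =
   (ph ⊠ v) @ (h ⊠ asym H B) @ (h ⊠ m ⊠ b).
  have -> : h ⊠ h ⊠ ((b ⊠ v) @ asym H B) = (h ⊠ h ⊠ b ⊠ v) @ (h ⊠ h ⊠ asym H B).
    by rewrite -[in RHS](atensA (h ⊠ h)) interchange; simp_id.
  have -> : (ph ⊠ ph) @ (h ⊠ asym H B ⊠ b) @ ((h ⊠ h ⊠ b ⊠ v) @ (h ⊠ h ⊠ asym H B)) =
    (ph ⊠ (ph @ (h ⊠ v))) @ (h ⊠ asym (tens H H) B).
    rewrite asym_hexl.
    have -> : h ⊠ (asym H B ⊠ h @ h ⊠ asym H B) = (h ⊠ asym H B ⊠ h) @ (h ⊠ h ⊠ asym H B).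
      by rewrite -!(atensA h) [in RHS]interchange; simp_id.
    rewrite !acompA; congr (_ @ _).
    have -> : ph ⊠ (ph @ h ⊠ v) = (ph ⊠ ph) @ (h ⊠ b ⊠ (h ⊠ v)) by rewrite interchange; simp_id.
    rewrite -!acompA; congr (_ @ _).
    by rewrite atensA -(atensA h h b) -(atensA h b h) !interchange; simp_id.
  rewrite -u1_mul.
  have -> : ph ⊠ (v @ m) = (ph ⊠ v) @ (h ⊠ b ⊠ m) by rewrite interchange; simp_id.
  rewrite -!acompA; congr (_ @ _).
  by rewrite -!atensA !interchange -asym_nat.
rewrite [LHS]acompA [LHS]acompA e2 -!acompA apairA apair_comp tgt_pair // aidl.
by rewrite -apairA apair_comp apair_sym aidl apairA apair_comp.
Qed.

(** The same computation as for [cmul_act1_tgt], after exchanging 1_1 and 1_2 by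
    cocommutativity. *)
Lemma act1_cmul_tgt f x : comult x -> cmul (act1 x) f = cmul (act1 x) (act (tgt x) f).
Proof.
move=> hx; apply: pk_inj; rewrite pk_cmul_unit pk_cmul pk_act !pk_act1.
have Zc : c @ (1H @ cou E) = 1H @ cou E by rewrite acompA unit_cocomm.
have := tgt_pair hx.
set Z := 1H @ cou E in Zc *.
move=> tp.
rewrite -!acompA; congr (_ @ _).
have -> : ap Z (ap (v @ pk x) (pk f)) =
  (h ⊠ h ⊠ v ⊠ b) @ ap Z (ap (pk x) (pk f)).
  by rewrite -(atensA _ v b) !apair_comp; simp_id.
have e2 : (ph ⊠ ph) @ (h ⊠ asym H B ⊠ b) @ (h ⊠ h ⊠ v ⊠ b) =
   (v ⊠ ph) @ (((m ⊠ h) @ (h ⊠ c)) ⊠ b).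
  have e3 : (h ⊠ asym H B ⊠ b) @ (h ⊠ h ⊠ v ⊠ b) = (h ⊠ v ⊠ h ⊠ b) @ (h ⊠ c ⊠ b).
    by rewrite -(atensA h h v) -(atensA h v h) !interchange asym_nat; simp_id.
  rewrite -[LHS]acompA e3 [LHS]acompA.
  have -> : (ph ⊠ ph) @ (h ⊠ v ⊠ h ⊠ b) = (v ⊠ ph) @ (m ⊠ h ⊠ b).
    by rewrite -(atensA _ h b) -(atensA m h b) !interchange -u1_mul; simp_id.
  by rewrite -[LHS]acompA interchange aidl.
have e4 : (m ⊠ h) @ ((h ⊠ c) @ ap Z (pk x)) = ap (pk x) (pk (tgt x)).
  rewrite -Zc -[X in ap _ X](aidl (B' := H)) -apair_comp.
  rewrite [X in _ @ X]acompA -asym_hexr [LHS]acompA -asym_nat.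
  by rewrite -[LHS]acompA tp apair_sym.
rewrite [LHS]acompA [LHS]acompA e2 -!acompA apairA apair_comp -[X in ap X _]acompA e4.
by rewrite aidl -apairA apair_comp.
Qed.

(** Pi(x) is the product of x and its antipode, so Pi(x) ▷ 1 has the form
    x ▷ g and is absorbed by x ▷ 1; the converse absorption is
    [cmul_act1_tgt] at f = 1. *)
Lemma act1_tgt x : comult x -> act1 (tgt x) = act1 x.
Proof.
move=> hx; have e : act1 x = cmul (act1 (tgt x)) (act1 x).
  by rewrite -{1}[act1 x]cmul1l cmul_act1_tgt.
rewrite e -[in LHS]pmul_antipode // -act_act1 -[X in act x X]cmul1r act_mul //.
by rewrite act_act1 pmul_antipode.
Qed.

Lemma act_act1_absorb x f : comult x -> cmul (act x f) (act1 x) = act x f.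
Proof. by move=> hx; rewrite -act_mul // cmul1r. Qed.

Lemma act1_act_absorb x f : comult x -> cmul (act1 x) (act x f) = act x f.
Proof. by move=> hx; rewrite -act_mul // cmul1l. Qed.

Lemma act_tgt x f : comult x -> act (tgt x) f = cmul f (act1 x).
Proof.
move=> hx; rewrite cmul_act1_tgt // -[in RHS](act1_tgt hx) act_act1_absorb //.
exact: comult_tgt.
Qed.

(** Both products are the action of the target of [x]. *)
Lemma act1_central x f : comult x -> cmul (act1 x) f = cmul f (act1 x).
Proof.
move=> hx; rewrite act1_cmul_tgt // -{1}(act1_tgt hx) act1_act_absorb ?act_tgt //.
exact: comult_tgt.
Qed.

(** x_1 Pi(y_1) ⊗ x_2 y_2 = x_1 1_1 ⊗ x_2 1_2 y = x_1 ⊗ x_2 y: a factor that comes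
    with the product x y may ignore the target of y. *)
Lemma mul_tgt_pair x y : comult x -> comult y ->
  pair E (pmul x y) (pmul x (tgt y)) = pair E (pmul x y) x.
Proof.
move=> hx hy; suff e : ap (pk (pmul x (tgt y))) (pk (pmul x y)) = ap (pk x) (pk (pmul x y)).
  by apply: pk_inj; rewrite !pk_pair -[LHS]apair_sym e apair_sym.
have e : mu2 H @ (d ⊠ ((h ⊠ m) @ (1H ⊠ h))) = (h ⊠ m) @ (d ⊠ h).
  have -> : d ⊠ ((h ⊠ m) @ (1H ⊠ h)) = (h ⊠ h ⊠ h ⊠ m) @ (d ⊠ 1H ⊠ h).
    by rewrite -(atensA (h ⊠ h)) -(atensA d) interchange; simp_id.
  have -> : mu2 H @ ((h ⊠ h ⊠ h ⊠ m) @ (d ⊠ 1H ⊠ h)) = (h ⊠ m) @ ((mu2 H @ (d ⊠ 1H)) ⊠ h).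
    have -> : (mu2 H @ (d ⊠ 1H)) ⊠ h = (mu2 H ⊠ h) @ (d ⊠ 1H ⊠ h) by rewrite interchange aidl.
    rewrite [LHS]acompA [RHS]acompA; congr (_ @ _).
    have -> : mu2 H ⊠ h = (m ⊠ m ⊠ h) @ (h ⊠ c ⊠ h ⊠ h) by rewrite interchange aidl.
    rewrite [RHS]acompA -(atensA m) interchange (wb_assoc wb) /mu2 -[LHS]acompA.
    have -> : (h ⊠ c ⊠ h) @ (h ⊠ h ⊠ h ⊠ m) = (h ⊠ h ⊠ (h ⊠ m)) @ (h ⊠ c ⊠ h ⊠ h).
      by rewrite !atensA -(atensA h h h) -!(atensA _ h h) !interchange; simp_id.
    by rewrite [LHS]acompA !interchange; simp_id.
  by rewrite (deltamu_unitr wb).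
rewrite !pk_pmul -mu2_pair -[ap (pk x) (pk x)]pk_pair -hx pk_comp.
rewrite tgt_pair_split // -apair_comp [LHS]acompA e -[LHS]acompA apair_comp.
by rewrite -pk_comp hx pk_pair aidl -apairA apair_comp aidl.
Qed.

(** The value of a 2-cochain at two points. *)
Definition ev2 (s : Hom (tens H H) B) (x y : Hom E H) : Hom E B := comp s (pair E x y).

Lemma pk_ev2 s x y : pk (ev2 s x y) = pk s @ ap (pk x) (pk y).
Proof. by rewrite pk_comp pk_pair. Qed.

Lemma act1_ev2_tgt s x y z : comult x -> comult y -> comult z ->
  cmul (act1 (pmul x (pmul y z))) (ev2 s x (pmul y (tgt z))) =
  cmul (act1 (pmul x (pmul y z))) (ev2 s x y).
Proof.
move=> hx hy hz.
have e w : pk (cmul (act1 (pmul x (pmul y z))) (ev2 s x w)) =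
  mB @ ((v @ m) ⊠ pk s) @ (h ⊠ c ⊠ h) @ ap (ap (pk x) (pk x)) (ap (pk (pmul y z)) (pk w)).
  rewrite pk_cmul pk_act1 pk_ev2 pk_pmul -!acompA; congr (_ @ _).
  by rewrite apair_swap apair_comp -acompA.
by apply: pk_inj; rewrite !e -!pk_pair mul_tgt_pair.
Qed.

(** A cochain that absorbs its unit has it as a factor, and next to this factor
    [mul_tgt_pair] deletes the target of [z].  This computes the last coface
    operator without evaluating the target map. *)
Lemma ev2_tgt s x y z : comult x -> comult y -> comult z ->
  (forall x' y', comult x' -> comult y' ->
     cmul (act1 (pmul x' y')) (ev2 s x' y') = ev2 s x' y') ->
  ev2 s x (pmul y (tgt z)) = cmul (act1 (pmul x (pmul y z))) (ev2 s x y).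
Proof.
move=> hx hy hz hs; have hz' := comult_tgt hz; have hyz := comult_mul hy hz'.
rewrite -hs // pmulA -act_act1 act1_tgt // act_act1 -pmulA.
exact: act1_ev2_tgt.
Qed.

Lemma act_twist s x y f : comult x -> comult y -> twisted phi s ->
  cmul (act x (act y f)) (ev2 s x y) = cmul (ev2 s x y) (act (pmul x y) f).
Proof.
move=> hx hy /mor_eqP tw.
rewrite !pk_scomp !pk_tens !pk_scomp !pk_tens pk_tens_delta in tw.
rewrite -!/(aid H) -!/(aid B) -!/(asym H B) in tw.
set Pp := (ph ⊠ h) @ _ @ _ in tw; set Fs := _ @ (_ @ (d ⊠ d)) in tw.
have tPp : typed Pp (tens H B) (tens B H) by exact: (typed_cast (F := Pp) _ _ _).
have tFs : typed Fs (tens H H) (tens B H) by exact: (typed_cast (F := Fs) _ _ _).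
have PpE w g : comult w -> Pp @ ap (pk w) (pk g) = ap (pk (act w g)) (pk w).
  move=> hw; rewrite /Pp -!acompA apair_comp -pk_comp hw pk_pair aidl -apairA.
  by rewrite apair_comp apair_sym aidl apairA apair_comp aidl pk_act.
have FsE : Fs @ ap (pk x) (pk y) = ap (pk (ev2 s x y)) (pk (pmul x y)).
  rewrite /Fs -!acompA apair_comp -!pk_comp hx hy !pk_pair apair_swap apair_comp.
  by rewrite pk_ev2 pk_pmul.
have := congr1 (fun k => k @ ap (pk x) (ap (pk y) (pk f))) tw.
rewrite -!acompA apair_comp aidl PpE // [X in (Fs ⊠ b) @ X]apairA apair_comp FsE aidl.
rewrite apairA apair_comp aidl PpE // -!apairA !apair_comp !aidl => e.
by apply: pk_inj; rewrite !pk_cmul pk_ev2 e -pk_ev2 -pk_act.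
Qed.

Local Notation "f ⋆ g" := (cmul f g) (at level 40, left associativity).
Local Notation "x ∙ y" := (pmul x y) (at level 38, left associativity).
Local Notation "x ▷ f" := (act x f) (at level 39, right associativity).

Lemma act1_mul_absorb x y : comult x -> act1 x ⋆ act1 (x ∙ y) = act1 (x ∙ y).
Proof. by move=> hx; rewrite -act_act1 act1_act_absorb. Qed.

Lemma act1_idem x : comult x -> act1 x ⋆ act1 x = act1 x.
Proof. exact: act1_act_absorb. Qed.

End Source.

Lemma cmul_comp (E E' : ccoalg (C := C)) (r : Hom E' E) f g :
  comult E' E r -> comp (cmul f g) r = cmul (comp f r) (comp g r).
Proof. by move=> hr; rewrite /cmul -compA pair_precomp. Qed.

Local Notation "f ⋆ g" := (cmul f g) (at level 40, left associativity).
Local Notation "x ∙ y" := (pmul x y) (at level 38, left associativity).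
Local Notation "x ▷ f" := (act x f) (at level 39, right associativity).

(** * The pre-obstruction on points *)
Section Cocycle.

Variables s t : Hom (tens H H) B.
Hypothesis s_tw : twisted phi s.
Hypothesis s_reg : is_reg_inverse phi (n := 2) s t.
Local Notation s_ := (ev2 s).
Local Notation t_ := (ev2 t).

Section CocycleSource.
Variable E : ccoalg (C := C).
Local Notation comult := (comult E cH).
Implicit Types (x y z w : Hom E H) (f g : Hom E B).

Lemma ev2_cconv s1 s2 x y : comult x -> comult y ->
  ev2 s1 x y ⋆ ev2 s2 x y = ev2 (cconv (n := 2) s1 s2) x y.
Proof.
move=> hx hy; rewrite -!/(comp _ (pair E x y)) -(cmul_comp (E := tens_ccoalg cH cH)).
  by rewrite /ev2 /cmul /pair compA.
exact: (comult_pair hx hy).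
Qed.

Lemma ev2_un x y : ev2 (un phi 2) x y = act1 (x ∙ y).
Proof.
apply: pk_inj; rewrite pk_act1 pk_ev2 pk_pmul !pk_scomp pk_tens -!/(aid _).
by simp_id; rewrite acompA.
Qed.

Lemma ev2_mulV x y : comult x -> comult y -> s_ x y ⋆ t_ x y = act1 (x ∙ y).
Proof. by move=> hx hy; rewrite ev2_cconv //; case: s_reg => -> _ _ _; apply: ev2_un. Qed.

Lemma ev2_Vmul x y : comult x -> comult y -> t_ x y ⋆ s_ x y = act1 (x ∙ y).
Proof. by move=> hx hy; rewrite ev2_cconv //; case: s_reg => _ -> _ _; apply: ev2_un. Qed.

Lemma act1_ev2 x y : comult x -> comult y -> act1 (x ∙ y) ⋆ s_ x y = s_ x y.
Proof.
move=> hx hy; rewrite -ev2_un ev2_cconv //.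
by case: s_reg => <- _ e _; rewrite e.
Qed.

Lemma act1_ev2V x y : comult x -> comult y -> act1 (x ∙ y) ⋆ t_ x y = t_ x y.
Proof.
move=> hx hy; rewrite -ev2_un ev2_cconv //.
by case: s_reg => _ <- _ e; rewrite e.
Qed.

(** With x' the antipode of x and tau the inverse of sigma, the twisted condition
    makes x ▷ x' ▷ _ the conjugation by sigma(x, x'), up to x ▷ 1.  The preimage
    is therefore x' ▷ (tau(x, x') f sigma(x, x')). *)
Lemma act_surj x f : comult x -> exists g, x ▷ g = act1 x ⋆ f.
Proof.
move=> hx; pose x' := comp (wh_lambda H) x.
have hx' : comult x' by apply: comult_lambda.
have xx' : x ∙ x' = tgt x by apply: pmul_antipode.
have su : s_ x x' ⋆ t_ x x' = act1 x by rewrite ev2_mulV // xx' act1_tgt.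
exists (x' ▷ (t_ x x' ⋆ f ⋆ s_ x x')); set g := _ ⋆ s_ _ _.
rewrite -(act_act1_absorb _ hx) -su cmulA act_twist // xx' act_tgt //.
rewrite cmulA -(cmulA _ (act1 x)) act1_central // cmulA /g !cmulA su.
rewrite -(cmulA _ (s_ _ _) (t_ _ _)) su -cmulA act1_idem //.
by rewrite -cmulA -act1_central // cmulA act1_idem.
Qed.

(** In the crossed product of [B] by [H] with cocycle [sigma], [rbr] and [lbr] are
    the coefficients of the products of x, y and z bracketed to the right and to
    the left. *)
Definition rbr x y z := x ▷ s_ y z ⋆ s_ x (y ∙ z).
Definition rbr_inv x y z := t_ x (y ∙ z) ⋆ x ▷ t_ y z.
Definition lbr x y z := s_ x y ⋆ s_ (x ∙ y) z.
Definition lbr_inv x y z := t_ (x ∙ y) z ⋆ t_ x y.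
Definition omega x y z := rbr x y z ⋆ lbr_inv x y z.

Section Triple.
Variables x y z : Hom E H.
Hypotheses (hx : comult x) (hy : comult y) (hz : comult z).
Let U := act1 (x ∙ (y ∙ z)).
Let hxy : comult (x ∙ y) := comult_mul hx hy.
Let hyz : comult (y ∙ z) := comult_mul hy hz.
Let hxyz : comult (x ∙ (y ∙ z)) := comult_mul hx hyz.

Lemma U_central f : U ⋆ f = f ⋆ U.
Proof. exact: act1_central. Qed.

Lemma act1_xyz_xy : U ⋆ act1 (x ∙ y) = U.
Proof. by rewrite U_central /U pmulA act1_mul_absorb. Qed.

Lemma act1_xyz_x : U ⋆ act1 x = U.
Proof. by rewrite U_central /U act1_mul_absorb. Qed.

Lemma rbr_mulV : rbr x y z ⋆ rbr_inv x y z = U.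
Proof.
rewrite /rbr /rbr_inv cmulA -(cmulA _ (s_ _ _)) ev2_mulV // -/U -U_central -cmulA.
by rewrite -act_mul // ev2_mulV // act_act1 -/U act1_idem.
Qed.

Lemma lbr_mulV : lbr x y z ⋆ lbr_inv x y z = U.
Proof.
rewrite /lbr /lbr_inv cmulA -(cmulA _ (s_ (x ∙ y) _)) ev2_mulV // -pmulA -/U.
rewrite -U_central -cmulA ev2_mulV //.
exact: act1_xyz_xy.
Qed.

Lemma lbr_Vmul : lbr_inv x y z ⋆ lbr x y z = U.
Proof.
rewrite /lbr /lbr_inv cmulA -(cmulA _ (t_ x y)) ev2_Vmul // -cmulA [X in _ ⋆ X]act1_central //.
by rewrite cmulA ev2_Vmul // -pmulA; exact: act1_xyz_xy.
Qed.

Lemma act1_rbr : U ⋆ rbr x y z = rbr x y z.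
Proof. by rewrite U_central /rbr -cmulA -U_central act1_ev2. Qed.

Lemma act1_lbr : U ⋆ lbr x y z = lbr x y z.
Proof. by rewrite U_central /lbr -cmulA -U_central /U pmulA act1_ev2. Qed.

Lemma act1_lbrV : U ⋆ lbr_inv x y z = lbr_inv x y z.
Proof. by rewrite /lbr_inv cmulA /U pmulA act1_ev2V. Qed.

Lemma twist_rbr f : x ▷ y ▷ z ▷ f ⋆ rbr x y z = rbr x y z ⋆ (x ∙ (y ∙ z)) ▷ f.
Proof.
rewrite /rbr cmulA -act_mul // act_twist // act_mul // -cmulA act_twist //.
by rewrite cmulA.
Qed.

Lemma twist_lbr f : x ▷ y ▷ z ▷ f ⋆ lbr x y z = lbr x y z ⋆ (x ∙ (y ∙ z)) ▷ f.
Proof.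
by rewrite /lbr cmulA act_twist // -cmulA act_twist // cmulA pmulA.
Qed.

Lemma act1_omega : U ⋆ omega x y z = omega x y z.
Proof. by rewrite /omega cmulA act1_rbr. Qed.

(** By [twist_rbr] and [twist_lbr], both factors of [omega] intertwine the same two
    operators, in opposite directions. *)
Lemma omega_comm_act f : omega x y z ⋆ x ▷ y ▷ z ▷ f = x ▷ y ▷ z ▷ f ⋆ omega x y z.
Proof.
set Z := x ▷ _; set W := (x ∙ (y ∙ z)) ▷ f.
have e : lbr_inv x y z ⋆ Z = W ⋆ lbr_inv x y z.
  rewrite -{1}act1_lbrV -cmulA U_central -lbr_mulV cmulA -(cmulA _ Z) twist_lbr -/W.
  by rewrite cmulA lbr_Vmul U_central -cmulA act1_lbrV.
by rewrite /omega -cmulA e [LHS]cmulA [RHS]cmulA /Z twist_rbr.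
Qed.

Lemma omega_central f : omega x y z ⋆ f = f ⋆ omega x y z.
Proof.
have [f1 e1] := act_surj f hx; have [f2 e2] := act_surj f1 hy.
have [f3 e3] := act_surj f2 hz.
have e : x ▷ y ▷ z ▷ f3 = U ⋆ f.
  rewrite e3 act_mul // act_mul // act_act1 act_act1 e2 act_mul // act_act1 e1.
  by rewrite -/U !cmulA act1_xyz_xy act1_xyz_x.
have := omega_comm_act f3; rewrite e.
by rewrite [LHS]cmulA -U_central act1_omega U_central -[RHS]cmulA act1_omega.
Qed.

Lemma omega_lbr : omega x y z ⋆ lbr x y z = rbr x y z.
Proof. by rewrite /omega -cmulA lbr_Vmul -U_central act1_rbr. Qed.

Lemma omega_mulV : omega x y z ⋆ (lbr x y z ⋆ rbr_inv x y z) = U.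
Proof. by rewrite cmulA omega_lbr rbr_mulV. Qed.

Lemma omega_Vmul : lbr x y z ⋆ rbr_inv x y z ⋆ omega x y z = U.
Proof. by rewrite -omega_central omega_mulV. Qed.

Lemma act1_omegaV : U ⋆ (lbr x y z ⋆ rbr_inv x y z) = lbr x y z ⋆ rbr_inv x y z.
Proof. by rewrite cmulA act1_lbr. Qed.

End Triple.

Lemma omega_tgt x y z w : comult x -> comult y -> comult z -> comult w ->
  omega x y (z ∙ tgt w) = act1 (x ∙ (y ∙ (z ∙ w))) ⋆ omega x y z.
Proof.
move=> hx hy hz hw.
have [hxy hyz hzw] := And3 (comult_mul hx hy) (comult_mul hy hz) (comult_mul hz hw).
have hV := comult_mul hx (comult_mul hy hzw).
have e1 := ev2_tgt hy hz hw act1_ev2; have e2 := ev2_tgt hx hyz hw act1_ev2.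
have e3 := ev2_tgt hxy hz hw act1_ev2V.
rewrite -(pmulA y z w) in e2; rewrite -(pmulA x y (z ∙ w)) in e3.
rewrite /omega /rbr /lbr_inv pmulA e1 e2 e3 act_mul // act_act1.
set V := act1 _; have cV f : f ⋆ V = V ⋆ f by rewrite /V act1_central.
have VV : V ⋆ V = V by apply: act1_idem.
have k f g : V ⋆ f ⋆ (V ⋆ g) = V ⋆ (f ⋆ g).
  by rewrite cmulA -(cmulA V f) cV (cmulA V V) VV -cmulA.
by rewrite k -(cmulA V (t_ _ _)) k.
Qed.

Lemma omega_assoc x y z : comult x -> comult y -> comult z ->
  x ▷ s_ y z ⋆ s_ x (y ∙ z) = omega x y z ⋆ s_ x y ⋆ s_ (x ∙ y) z.
Proof. by move=> hx hy hz; rewrite -cmulA; exact: esym (omega_lbr hx hy hz). Qed.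

(** [J1] and [J2] expand the same product from the right and from the left.  The
    values of [omega] are abstracted, keeping only [omega_assoc], centrality and
    absorption of the unit. *)
Lemma omega_cocycle x y z w : comult x -> comult y -> comult z -> comult w ->
  x ▷ omega y z w ⋆ omega x (y ∙ z) w ⋆ (act1 (x ∙ (y ∙ (z ∙ w))) ⋆ omega x y z) =
  omega (x ∙ y) z w ⋆ omega x y (z ∙ w).
Proof.
move=> hx hy hz hw.
have [hxy hyz hzw] := And3 (comult_mul hx hy) (comult_mul hy hz) (comult_mul hz hw).
have r1 := omega_assoc hy hz hw; have r2 := omega_assoc hx hyz hw; have r3 := omega_assoc hx hy hz.
have r4 := omega_assoc hx hy hzw; have r5 := omega_assoc hxy hz hw.
have c2 := omega_central hx hyz hw; have c4 := omega_central hx hy hzw.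
have c5 := omega_central hxy hz hw; have u5 := act1_omega hxy hz hw.
rewrite -pmulA in u5.
move: (omega y z w) (omega x (y ∙ z) w) (omega x y z) (omega x y (z ∙ w)) (omega (x ∙ y) z w)
  r1 r2 r3 r4 r5 c2 c4 c5 u5 => a b0 k p q r1 r2 r3 r4 r5 c2 c4 c5 u5.
set V := act1 _ in u5 *.
pose N := s_ x y ⋆ s_ (x ∙ y) z ⋆ s_ (x ∙ y ∙ z) w.
pose N' := t_ (x ∙ y ∙ z) w ⋆ t_ (x ∙ y) z ⋆ t_ x y.
have cV f : f ⋆ V = V ⋆ f by rewrite /V act1_central //; do 2!apply: comult_mul => //.
have NN' : N ⋆ N' = V.
  have VE : V = act1 (x ∙ y ∙ z ∙ w) by rewrite -!pmulA.
  have hxy_z := comult_mul hxy hz.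
  rewrite /N /N' !cmulA -(cmulA _ (s_ (x ∙ y ∙ z) w)) ev2_mulV // -VE cV.
  rewrite -!cmulA (cmulA (s_ (x ∙ y) z)) ev2_mulV // (cmulA (s_ x y)).
  rewrite -act1_central // -cmulA ev2_mulV //.
  rewrite cmulA -(cV (act1 (x ∙ y ∙ z))) VE act1_mul_absorb // -act1_central //.
  by rewrite -(pmulA (x ∙ y)) act1_mul_absorb.
have J1 : x ▷ y ▷ s_ z w ⋆ x ▷ s_ y (z ∙ w) ⋆ s_ x (y ∙ (z ∙ w)) = x ▷ a ⋆ b0 ⋆ k ⋆ N.
  rewrite -act_mul // r1 -(cmulA a) !act_mul // -!cmulA pmulA r2.
  rewrite (cmulA (x ▷ s_ y z)) (cmulA (x ▷ s_ y z)) -c2 /N.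
  by rewrite -!cmulA (cmulA (x ▷ s_ y z)) r3 -!cmulA pmulA.
have J2 : x ▷ y ▷ s_ z w ⋆ x ▷ s_ y (z ∙ w) ⋆ s_ x (y ∙ (z ∙ w)) = q ⋆ p ⋆ N.
  rewrite -cmulA r4 !cmulA -c4 -(cmulA p) act_twist // -!cmulA r5 /N.
  rewrite -!cmulA [RHS]cmulA (c5 p) -[RHS]cmulA [in RHS](cmulA q) (c5 (s_ x y)).
  by rewrite -!cmulA.
have /= := congr1 (fun f => f ⋆ N') (esym J1); rewrite J2 -!(cmulA _ N) NN'.
by rewrite -(cmulA _ k) cV => ->; rewrite cV cmulA u5.
Qed.

End CocycleSource.

End Cocycle.

End Points.

(** * Cochains and their values at points *)
Section Cochains.
Context {C : strict_symmetric_monoidal}.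
Variables (H : weak_hopf C) (Hco : cocommutative H).
Variables (B : algebra C) (phi : Hom (tens H B) B).
Hypothesis Bw : is_weak_module_algebra phi.
Local Notation cH := (wh_ccoalg Hco).
Local Notation E2 := (tens_ccoalg cH cH).
Local Notation E3 := (tens_ccoalg cH E2).
Local Notation E4 := (tens_ccoalg cH E3).
Local Notation h := (aid H).
Local Notation m := (pk (wh_mu H)).
Local Notation ph := (pk phi).
Local Notation P := (pk (PiL H)).
Local Notation act := (act phi).
Local Notation act1 := (act1 phi).

Local Notation "f ⋆ g" := (cmul f g) (at level 40, left associativity).
Local Notation "x ∙ y" := (pmul x y) (at level 38, left associativity).
Local Notation "x ▷ f" := (act x f) (at level 39, right associativity).

Lemma pk_coface_first k (hk : (0 < k) && (0 <= k.+1)) (s : Hom (tpow H k) B) :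
  pk (coface phi hk s) = ph @ (h ⊠ pk s).
Proof. by rewrite pk_recast pk_scomp. Qed.

Lemma pk_coface_mid k i (hi : (0 < k) && (i.+1 <= k.+1)) (s : Hom (tpow H k) B) :
  i.+1 <= k ->
  pk (coface phi hi s) = pk s @ (aid (tpow H i) ⊠ m ⊠ aid (tpow H (k - i.+1))).
Proof.
move=> ik; set R := RHS; rewrite /coface /=.
by move: (erefl _); rewrite {2 3}ik => e; rewrite pk_scomp pk_recast.
Qed.

Lemma pk_coface_last k (hk : (0 < k.+1) && (k.+2 <= k.+2)) (s : Hom (tpow H k.+1) B) :
  pk (coface phi hk s) = pk s @ (aid (tpow H k) ⊠ (m @ (h ⊠ P))).
Proof.
set R := RHS; rewrite /coface /=.
have ik : (k.+1 < k.+1) = false by rewrite ltnn.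
move: (erefl _); rewrite {2 3}ik => e.
by rewrite pk_scomp pk_recast pk_tens pk_scomp.
Qed.

Local Notation p1 := (cproj1 cH E2).
Local Notation p2 := (comp (cproj1 cH cH) (cproj2 cH E2)).
Local Notation p3 := (comp (cproj2 cH cH) (cproj2 cH E2)).

Lemma pair_p123 : pair E3 p1 (pair E3 p2 p3) = idm E3.
Proof.
rewrite -pair_precomp; last exact: comult_cproj2.
by rewrite pair_cproj comp_idl pair_cproj.
Qed.

Section Evaluation.
Variable E : ccoalg (C := C).
Implicit Types (x y z w : Hom E H).
Local Notation ap := (apair E).
Local Notation comult := (comult E cH).

(** Cochains are evaluated directly, and not by substituting points for the
    projections in a formula: since points are not counital, composing a
    projection with a pairing does not give back the component. *)
Definition ev3 (f : Hom (tpow H 3) B) x y z : Hom E B := comp f (pair E x (pair E y z)).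

Definition ev4 (f : Hom (tpow H 4) B) x y z w : Hom E B :=
  comp f (pair E x (pair E y (pair E z w))).

Lemma pk_ev3 f x y z : pk (ev3 f x y z) = pk f @ ap (pk x) (ap (pk y) (pk z)).
Proof. by rewrite pk_comp !pk_pair. Qed.

Lemma pk_ev4 f x y z w :
  pk (ev4 f x y z w) = pk f @ ap (pk x) (ap (pk y) (ap (pk z) (pk w))).
Proof. by rewrite pk_comp !pk_pair. Qed.

Lemma ev3_cconv f g x y z : comult x -> comult y -> comult z ->
  ev3 (cconv f g) x y z = ev3 f x y z ⋆ ev3 g x y z.
Proof.
move=> hx hy hz; have hr := comult_pair hx (comult_pair hy hz).
rewrite /ev3 -(cmul_comp (E := E3) _ _ hr).
by congr comp; rewrite /cmul /pair compA.
Qed.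

Lemma ev4_cconv f g x y z w : comult x -> comult y -> comult z -> comult w ->
  ev4 (cconv f g) x y z w = ev4 f x y z w ⋆ ev4 g x y z w.
Proof.
move=> hx hy hz hw; have hr := comult_pair hx (comult_pair hy (comult_pair hz hw)).
rewrite /ev4 -(cmul_comp (E := E4) _ _ hr).
by congr comp; rewrite /cmul /pair compA.
Qed.

Lemma ev3_un x y z : ev3 (un phi 3) x y z = act1 (x ∙ (y ∙ z)).
Proof.
apply: pk_inj; rewrite pk_act1 pk_ev3 !pk_pmul !pk_scomp !pk_tens pk_scomp pk_tens -!/(aid H).
by simp_id; rewrite -acompA -acompA apair_comp aidl.
Qed.

Lemma ev3_coface0 s x y z : ev3 ((∂_(2, 0) phi)%mor s) x y z = x ▷ ev2 s y z.
Proof.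
by apply: pk_inj; rewrite pk_ev3 pk_coface_first pk_act pk_ev2 -acompA apair_comp aidl.
Qed.

Lemma ev3_coface1 s x y z : ev3 ((∂_(2, 1) phi)%mor s) x y z = ev2 s (x ∙ y) z.
Proof.
apply: pk_inj; rewrite pk_ev3 pk_coface_mid // pk_ev2 pk_pmul -acompA /= atens1l.
by rewrite apairA apair_comp aidl.
Qed.

Lemma ev3_coface2 s x y z : ev3 ((∂_(2, 2) phi)%mor s) x y z = ev2 s x (y ∙ z).
Proof.
apply: pk_inj; rewrite pk_ev3 pk_coface_mid // pk_ev2 pk_pmul -acompA /= atens1r.
by rewrite apair_comp aidl.
Qed.

Lemma ev3_coface3 s x y z : ev3 ((∂_(2, 3) phi)%mor s) x y z = ev2 s x (y ∙ tgt z).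
Proof.
apply: pk_inj; rewrite pk_ev3 pk_coface_last // pk_ev2 pk_pmul pk_comp -acompA /=.
by rewrite apair_comp aidl -acompA apair_comp aidl.
Qed.

Lemma ev4_coface0 f x y z w : ev4 ((∂_(3, 0) phi)%mor f) x y z w = x ▷ ev3 f y z w.
Proof.
by apply: pk_inj; rewrite pk_ev4 pk_coface_first pk_act pk_ev3 -acompA apair_comp aidl.
Qed.

Lemma ev4_coface1 f x y z w : ev4 ((∂_(3, 1) phi)%mor f) x y z w = ev3 f (x ∙ y) z w.
Proof.
apply: pk_inj; rewrite pk_ev4 pk_coface_mid // pk_ev3 pk_pmul -acompA /= atens1l.
by rewrite apairA apair_comp aidl.
Qed.

Lemma ev4_coface2 f x y z w : ev4 ((∂_(3, 2) phi)%mor f) x y z w = ev3 f x (y ∙ z) w.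
Proof.
apply: pk_inj; rewrite pk_ev4 pk_coface_mid // pk_ev3 pk_pmul -acompA /=.
by rewrite [X in ap _ X]apairA -(atensA h) !apair_comp !aidl.
Qed.

Lemma ev4_coface3 f x y z w : ev4 ((∂_(3, 3) phi)%mor f) x y z w = ev3 f x y (z ∙ w).
Proof.
apply: pk_inj; rewrite pk_ev4 pk_coface_mid // pk_ev3 pk_pmul -acompA /= atens1r.
by rewrite aid_tens -(atensA h) !apair_comp !aidl.
Qed.

Lemma ev4_coface4 f x y z w : ev4 ((∂_(3, 4) phi)%mor f) x y z w = ev3 f x y (z ∙ tgt w).
Proof.
apply: pk_inj; rewrite pk_ev4 pk_coface_last // pk_ev3 pk_pmul pk_comp -acompA /=.
by rewrite aid_tens -(atensA h) !apair_comp !aidl -acompA apair_comp aidl.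
Qed.

End Evaluation.

Local Notation p4_1 := (cproj1 cH E3).
Local Notation p4_2 := (comp p1 (cproj2 cH E3)).
Local Notation p4_3 := (comp p2 (cproj2 cH E3)).
Local Notation p4_4 := (comp p3 (cproj2 cH E3)).

(** It is enough to evaluate at the three projections, which pair to the
    identity. *)
Lemma cochain3_ext (f g : Hom (tpow H 3) B) :
  (forall x y z : Hom E3 H, comult E3 cH x -> comult E3 cH y -> comult E3 cH z ->
     ev3 (E := E3) f x y z = ev3 g x y z) -> f = g.
Proof.
have hp1 : comult E3 cH p1 by apply: comult_cproj1.
have hp : comult E3 E2 (cproj2 cH E2) by apply: comult_cproj2.
have hp2 : comult E3 cH p2 := comult_comp (comult_cproj1 cH cH) hp.
have hp3 : comult E3 cH p3 := comult_comp (comult_cproj2 cH cH) hp.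
move=> /(_ _ _ _ hp1 hp2 hp3).
by rewrite /ev3 pair_p123 !comp_idr.
Qed.

Lemma cochain4_ext (f g : Hom (tpow H 4) B) :
  (forall x y z w : Hom E4 H, comult E4 cH x -> comult E4 cH y ->
     comult E4 cH z -> comult E4 cH w ->
     ev4 (E := E4) f x y z w = ev4 g x y z w) -> f = g.
Proof.
have hp1 : comult E4 cH p4_1 by apply: comult_cproj1.
have hp : comult E4 E3 (cproj2 cH E3) by apply: comult_cproj2.
have hq : comult E3 E2 (cproj2 cH E2) by apply: comult_cproj2.
have hp2 : comult E4 cH p4_2 := comult_comp (comult_cproj1 cH E2) hp.
have hp3 : comult E4 cH p4_3 := comult_comp (comult_comp (comult_cproj1 cH cH) hq) hp.
have hp4 : comult E4 cH p4_4 := comult_comp (comult_comp (comult_cproj2 cH cH) hq) hp.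
move=> /(_ _ _ _ _ hp1 hp2 hp3 hp4).
rewrite /ev4 -!(pair_precomp _ _ hp) pair_p123 comp_idl.
by rewrite pair_cproj !comp_idr.
Qed.

Section Main.
Variables s t : Hom (tpow H 2) B.
Hypothesis s_tw : twisted phi s.
Hypothesis s_reg : is_reg_inverse phi s t.

Lemma reg_inv3_unique (f g k : Hom (tpow H 3) B) :
  is_reg_inverse phi f g -> is_reg_inverse phi f k -> g = k.
Proof.
have cA (a b c : Hom (tpow H 3) B) : cconv (cconv a b) c = cconv a (cconv b c).
  apply: cochain3_ext => x y z hx hy hz.
  by rewrite !ev3_cconv // cmulA.
case=> fg gf _ gfg [fk kf _ kfk].
by rewrite -gfg gf -kf cA fg -fk -cA kfk.
Qed.

Lemma reg_inv3E (f g : Hom (tpow H 3) B) : is_reg_inverse phi f g -> reg_inv phi f = g.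
Proof.
move=> fg; apply: (reg_inv3_unique _ fg).
by apply: (epsilon_spec _ (is_reg_inverse phi f)); exists g.
Qed.

(** The two conditions f f' f = f and f' f f' = f' amount to absorption of the
    unit, since f f' is the unit. *)
Lemma is_reg_inverse3 (f g : Hom (tpow H 3) B) :
  (forall x y z : Hom E3 H, comult E3 cH x -> comult E3 cH y -> comult E3 cH z ->
    let U := act1 (x ∙ (y ∙ z)) in let F := ev3 f x y z in let G := ev3 g x y z in
    [/\ F ⋆ G = U, G ⋆ F = U, U ⋆ F = F & U ⋆ G = G]) ->
  is_reg_inverse phi f g.
Proof.
move=> fg; split; apply: cochain3_ext => x y z hx hy hz;
  have [e1 e2 e3 e4] := fg _ _ _ hx hy hz;
  by rewrite !ev3_cconv ?ev3_un // ?e1 ?e2 // ?e3 ?e4.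
Qed.

Lemma coface1_inv : is_reg_inverse phi ((∂_(2, 1) phi)%mor s) ((∂_(2, 1) phi)%mor t).
Proof.
apply: is_reg_inverse3 => x y z hx hy hz; rewrite !ev3_coface1.
have hxy := comult_mul hx hy.
rewrite (pmulA Hco); split.
- exact: (ev2_mulV s_reg hxy hz).
- exact: (ev2_Vmul s_reg hxy hz).
- exact: (act1_ev2 s_reg hxy hz).
- exact: (act1_ev2V s_reg hxy hz).
Qed.

Lemma coface3_inv : is_reg_inverse phi ((∂_(2, 3) phi)%mor s) ((∂_(2, 3) phi)%mor t).
Proof.
apply: is_reg_inverse3 => x y z hx hy hz; rewrite !ev3_coface3.
have hyz : comult E3 cH (y ∙ tgt z) := comult_mul hy (comult_tgt hz).
have e : act1 (x ∙ (y ∙ z)) = act1 (x ∙ (y ∙ tgt z)).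
  by rewrite -!(act_act1 Bw) (act1_tgt Bw hz).
rewrite e; split.
- exact: (ev2_mulV s_reg hx hyz).
- exact: (ev2_Vmul s_reg hx hyz).
- exact: (act1_ev2 s_reg hx hyz).
- exact: (act1_ev2V s_reg hx hyz).
Qed.

(** The last coface operator contributes x y z ▷ 1 and tau(x, y), and the previous
    factor absorbs the former. *)
Lemma ev3_pre_obstruction (E : ccoalg (C := C)) (x y z : Hom E H) :
  comult E cH x -> comult E cH y -> comult E cH z ->
  ev3 (pre_obstruction phi s) x y z = omega phi s t x y z.
Proof.
move=> hx hy hz; rewrite /pre_obstruction (reg_inv3E coface1_inv) (reg_inv3E coface3_inv).
rewrite !ev3_cconv // ev3_coface0 ev3_coface1 ev3_coface2 ev3_coface3.
rewrite (ev2_tgt Bw hx hy hz (act1_ev2V s_reg (E := E))) /omega /rbr /lbr_inv.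
have hxy := comult_mul hx hy.
rewrite -!cmulA; congr (_ ⋆ (_ ⋆ _)).
have hxyz := comult_mul hx (comult_mul hy hz).
by rewrite cmulA -(act1_central Bw _ hxyz) (pmulA Hco) (act1_ev2V s_reg hxy hz).
Qed.

Lemma pre_obstruction_cocycle : is_3cocycle phi (pre_obstruction phi s).
Proof.
split.
  exists (cconv (cconv ((∂_(2, 3) phi)%mor s) ((∂_(2, 1) phi)%mor s))
    (cconv ((∂_(2, 2) phi)%mor t) ((∂_(2, 0) phi)%mor t))).
  apply: is_reg_inverse3 => x y z hx hy hz /=.
  rewrite ev3_pre_obstruction // !ev3_cconv // ev3_coface0 ev3_coface1 ev3_coface2 ev3_coface3.
  rewrite (ev2_tgt Bw hx hy hz (act1_ev2 s_reg (E := E3))).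
  rewrite -(cmulA (act1 _)) -/(lbr s x y z) -/(rbr_inv phi t x y z) (act1_lbr Bw s_reg) //.
  split.
  - exact: (omega_mulV Bw s_reg hx hy hz).
  - exact: (omega_Vmul Bw s_tw s_reg hx hy hz).
  - exact: (act1_omega Bw s_reg hx hy hz).
  - exact: (act1_omegaV Bw s_reg hx hy hz).
apply: cochain4_ext => x y z w hx hy hz hw.
rewrite !ev4_cconv // ev4_coface0 ev4_coface1 ev4_coface2 ev4_coface3 ev4_coface4.
have [hxy hyz hzw] := And3 (comult_mul hx hy) (comult_mul hy hz) (comult_mul hz hw).
rewrite !ev3_pre_obstruction //; last exact: comult_mul hz (comult_tgt hw).
rewrite (omega_tgt Bw s_reg hx hy hz hw).
exact: (omega_cocycle Bw s_tw s_reg hx hy hz hw).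
Qed.

End Main.
End Cochains.

Close Scope arr_scope.

Theorem theorem5p11 (C : strict_symmetric_monoidal)
  (C_split : idempotents_split C)
  (H : weak_hopf C) (H_cocomm : cocommutative H)
  (B : algebra C) (phi : Hom (H ⊗ B) B)
  (B_wma : is_weak_module_algebra phi)
  (sigma : Hom (tpow H 2) B) (sigma_reg : Reg phi sigma)
  (sigma_tw : twisted phi sigma) :
  is_3cocycle phi (pre_obstruction phi sigma).
Proof.
have [tau sigma_tau] := sigma_reg.
exact: (pre_obstruction_cocycle H_cocomm B_wma sigma_tw sigma_tau).
Qed.
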